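(* Let $M$ be a non-Einstein and non-conformally flat hypersurface in a semi-Riemannian space of constant curvature $N_{s}^{n+1}(c)$, $n\geq 4$, with second fundamental tensor $H$. Let $\widetilde{\kappa}$ be the scalar curvature of $N_s^{n+1}(c)$, and let ${\mathcal U}_{H}\subset M$ be the set of all points at which $H^{2}$ is not a linear combination of $g$ and $H$. (i) If on ${\mathcal U}_{H}$ $$H^{3}=\mathrm{tr}(H)\, H^{2}+\psi\, H,$$ where $\psi$ is some function on ${\mathcal U}_{H}$, then on ${\mathcal U}_{H}$ $$C\cdot C=\frac{n-3}{n-2}\, Q\left(S-\left(\frac{(n-1)\widetilde{\kappa}}{n(n+1)}-\rho\right)g,\; R-\left(\frac{\widetilde{\kappa}}{n(n+1)}-\frac{\rho}{n-2}\right)\frac12\, g\wedge g\right),$$ where $$\rho=\frac{1}{n-3}\left(\frac{\kappa}{n-1}-\frac{\widetilde{\kappa}}{n+1}+\varepsilon\psi\right).$$ (ii) If on ${\mathcal U}_{H}$ $$C\cdot C=L_{C}\, Q(g,C)\qquad\text{and}\qquad H^{3}=\mathrm{tr}(H)\, H^{2}+\psi\, H,$$ where $L_{C}$ and $\psi$ are some functions on ${\mathcal U}_{H}$, then on ${\mathcal U}_{H}$ $$Q\left(S-\left(\frac{(n-1)\widetilde{\kappa}}{n(n+1)}-\tau\right)g,\; R-\left(\frac{\widetilde{\kappa}}{n(n+1)}-\frac{\tau}{n-2}\right)\frac12\, g\wedge g\right)=0,$$ where $$\tau=\rho-\frac{n-2}{n-3}\, L_{C},\qquad \rho=\frac{1}{n-3}\left(\frac{\kappa}{n-1}-\frac{\widetilde{\kappa}}{n+1}+\varepsilon\psi\right).$$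 Moreover, $\lambda\, C=E$ on ${\mathcal U}_{H}$, where $\lambda$ is some function on ${\mathcal U}_{H}$ and $$E=g\wedge S^{2}+\frac{n-2}{2}\, S\wedge S-\kappa\, g\wedge S+\frac{\kappa^{2}-\mathrm{tr}_{g}(S^{2})}{2(n-1)}\, g\wedge g.$$
   Context: Manifolds are connected, paracompact, of class $C^\infty$; metrics are nondegenerate of arbitrary signature. $N_{s}^{n+1}(c)$ is a semi-Riemannian space of constant curvature $c=\frac{\widetilde{\kappa}}{n(n+1)}$ with signature $(s,n+1-s)$ and scalar curvature $\widetilde{\kappa}$. $M$, $\dim M=n$, is a connected hypersurface isometrically immersed in $N_s^{n+1}(c)$; $g,R,S,\kappa,C$ denote its (semi-Riemannian) metric tensor, Riemann-Christoffel curvature tensor, Ricci tensor, scalar curvature and Weyl conformal curvature tensor, and $H$ its second fundamental tensor, so that the Gauss equation reads $R-\frac{\widetilde{\kappa}}{2n(n+1)}\, g\wedge g=\frac{\varepsilon}{2}\, H\wedge H$ with $\varepsilon=\pm1$. Here $\mathrm{tr}(H)$ is the trace with respect to $g$; with $g({\mathcal H}X,Y)=H(X,Y)$, $H^{2}(X,Y)=H({\mathcal H}X,Y)$ and $H^{3}(X,Y)=H^{2}({\mathcal H}X,Y)$. Conventions: ${\mathcal R}(X,Y)Z=\nabla_X\nabla_YZ-\nabla_Y\nabla_XZ-\nabla_{[X,Y]}Z$, $R(X_1,X_2,X_3,X_4)=g({\mathcal R}(X_1,X_2)X_3,X_4)$, $S(X,Y)=\mathrm{tr}\{Z\mapsto{\mathcal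 R}(Z,X)Y\}$, $g({\mathcal S}X,Y)=S(X,Y)$, $\kappa=\mathrm{tr}\,{\mathcal S}$, $S^{2}(X,Y)=S({\mathcal S}X,Y)$. The Kulkarni-Nomizu product of symmetric $(0,2)$-tensors $A,B$ is $$(A\wedge B)(X_1,X_2,X_3,X_4)=A(X_1,X_4)B(X_2,X_3)+A(X_2,X_3)B(X_1,X_4)-A(X_1,X_3)B(X_2,X_4)-A(X_2,X_4)B(X_1,X_3),$$ and $C=R-\frac{1}{n-2}\, g\wedge S+\frac{\kappa}{2(n-2)(n-1)}\, g\wedge g$. For a $(0,4)$-tensor $B(X_1,X_2,X_3,X_4)=g({\mathcal B}(X_1,X_2)X_3,X_4)$ with each ${\mathcal B}(X,Y)$ a skew-symmetric endomorphism, and a $(0,k)$-tensor $T$, $k\ge1$, $$(B\cdot T)(X_1,\ldots,X_k,X,Y)=-T({\mathcal B}(X,Y)X_1,X_2,\ldots,X_k)-\cdots-T(X_1,\ldots,X_{k-1},{\mathcal B}(X,Y)X_k).$$ For a symmetric $(0,2)$-tensor $A$, put $(X\wedge_AY)Z=A(Y,Z)X-A(X,Z)Y$ and $$Q(A,T)(X_1,\ldots,X_k,X,Y)=-T((X\wedge_AY)X_1,X_2,\ldots,X_k)-\cdots-T(X_1,\ldots,X_{k-1},(X\wedge_AY)X_k).$$ *)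

(* Defs.v *)
From HB Require Import structures.
From mathcomp Require Import all_boot all_order all_algebra.
From mathcomp Require Import all_classical all_reals all_analysis.
Set Implicit Arguments.
Unset Strict Implicit.
Unset Printing Implicit Defensive.
Import Order.TTheory GRing.Theory Num.Theory.
Import numFieldNormedType.Exports.
Local Open Scope classical_set_scope.
Local Open Scope ring_scope.

(*  A tangent space of an n-dimensional manifold is identified with ['rV[R]_n]
    through a chart, and covariant tensors are scalar functions of vectors.
    Sums, scalings and equalities of tensors are those of function spaces. *)

Notation form2 R n := ('rV[R]_n -> 'rV[R]_n -> R).
Notation form4 R n := ('rV[R]_n -> 'rV[R]_n -> 'rV[R]_n -> 'rV[R]_n -> R).
Notation form6 R n := ('rV[R]_n -> 'rV[R]_n -> form4 R n).

Definition gram (R : realType) (n : nat) (G : 'M[R]_n) : form2 R n :=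
  fun X Y => (X *m G *m Y^T) 0 0.

(* For G symmetric and invertible and a linear, this is the vector Z such that
   gram G Z Y = a Y for all Y. *)
Definition sharp (R : realType) (n : nat) (G : 'M[R]_n) (a : 'rV[R]_n -> R) :
  'rV[R]_n := (\row_j a (delta_mx 0 j)) *m invmx G.

Definition endo (R : realType) (n : nat) (G : 'M[R]_n) (A : form2 R n) :
  'rV[R]_n -> 'rV[R]_n := fun X => sharp G (A X).

Definition trace (R : realType) (n : nat) (f : 'rV[R]_n -> 'rV[R]_n) : R :=
  \sum_(i < n) f (delta_mx 0 i) 0 i.

Definition trace_g (R : realType) (n : nat) (G : 'M[R]_n) (A : form2 R n) : R :=
  trace (endo G A).

(* A(B X, Y), where B also denotes the endomorphism associated with B:
   H^2 = fmul G H H, H^3 = fmul G (H^2) H, S^2 = fmul G S S. *)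
Definition fmul (R : realType) (n : nat) (G : 'M[R]_n) (A B : form2 R n) :
  form2 R n := fun X Y => A (endo G B X) Y.

Definition kulkarni_nomizu (R : realType) (n : nat) (A B : form2 R n) :
  form4 R n :=
  fun X1 X2 X3 X4 => A X1 X4 * B X2 X3 + A X2 X3 * B X1 X4
                     - A X1 X3 * B X2 X4 - A X2 X4 * B X1 X3.

(* Derivation of a (0,4)-tensor T by a family D X Y of endomorphisms. *)
Definition derivation4 (R : realType) (n : nat)
    (D : 'rV[R]_n -> 'rV[R]_n -> 'rV[R]_n -> 'rV[R]_n) (T : form4 R n) :
  form6 R n :=
  fun X1 X2 X3 X4 X Y => - T (D X Y X1) X2 X3 X4 - T X1 (D X Y X2) X3 X4
                         - T X1 X2 (D X Y X3) X4 - T X1 X2 X3 (D X Y X4).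

(* The tensor B . T, for k = 4. *)
Definition tdot (R : realType) (n : nat) (G : 'M[R]_n) (B T : form4 R n) :
  form6 R n := derivation4 (fun X Y Z => sharp G (B X Y Z)) T.

(* The tensor Q(A, T), for k = 4. *)
Definition tachibana (R : realType) (n : nat) (A : form2 R n) (T : form4 R n) :
  form6 R n := derivation4 (fun X Y Z => A Y Z *: X - A X Z *: Y) T.

(* Signature (s, n - s), where s counts the minus signs. *)
Definition has_signature (R : realType) (n s : nat) (G : 'M[R]_n) : Prop :=
  (s <= n)%N /\
  exists2 P : 'M[R]_n, P \in unitmx &
    P *m G *m P^T = diag_mx (\row_(i < n) (if (i < s)%N then -1 else 1)).

Fixpoint Ck (R : realType) (n k : nat) (W : normedModType R)
    (U : set 'rV[R]_n) (f : 'rV[R]_n -> W) : Prop :=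
  match k with
  | 0%N => forall u, U u -> {for u, continuous f}
  | k'.+1 => (forall u, U u -> differentiable f u) /\
             forall i : 'I_n, Ck k' U (fun u => 'D_(delta_mx 0 i) f u)
  end.

(* C^infinity on U, to be used for U open. *)
Definition smooth (R : realType) (n : nat) (W : normedModType R)
    (U : set 'rV[R]_n) (f : 'rV[R]_n -> W) : Prop :=
  forall k, Ck k U f.

Definition open_cover (T : topologicalType) (C : set (set T)) : Prop :=
  (forall U, C U -> open U) /\ (forall p, exists2 U, C U & U p).

Definition paracompact (T : topologicalType) : Prop :=
  forall C : set (set T), open_cover C ->
  exists D : set (set T),
    [/\ open_cover D,
        forall V, D V -> exists2 U, C U & V `<=` U
      & forall p : T, exists2 W, nbhs p W &
          finite_set [set V | D V /\ V `&` W !=set0]].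

Record chart (R : realType) (n : nat) (M : topologicalType) := Chart {
  dom : set M;
  img : set 'rV[R]_n;
  coord : M -> 'rV[R]_n;
  param : 'rV[R]_n -> M;
  dom_open : open dom;
  img_open : open img;
  coord_img : forall p, dom p -> img (coord p);
  param_dom : forall u, img u -> dom (param u);
  coordK : forall p, dom p -> param (coord p) = p;
  paramK : forall u, img u -> coord (param u) = u;
  coord_continuous : forall p, dom p -> {for p, continuous coord};
  param_continuous : forall u, img u -> {for u, continuous param}
}.

(* chart_at selects a chart around each point; T_pM is identified with
   'rV[R]_n through chart_at p. *)
Record manifold (R : realType) (n : nat) := Manifold {
  points :> topologicalType;
  manifold_hausdorff : hausdorff_space points;
  manifold_connected : connected [set: points];
  manifold_paracompact : paracompact points;
  atlas : set (chart R n points);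
  chart_at : points -> chart R n points;
  chart_at_atlas : forall p, atlas (chart_at p);
  chart_at_dom : forall p, dom (chart_at p) p;
  transition_smooth : forall x y, atlas x -> atlas y ->
    smooth (img x `&` param x @^-1` dom y) (coord y \o param x)
}.

(* gmx x u is the matrix of components of the metric tensor in the chart x,
   at the point with coordinates u. *)
Record metric (R : realType) (n : nat) (M : manifold R n) := Metric {
  gmx : chart R n M -> 'rV[R]_n -> 'M[R]_n;
  gmx_smooth : forall x, atlas x -> smooth (img x) (gmx x);
  gmx_sym : forall x u, atlas x -> img x u -> (gmx x u)^T = gmx x u;
  gmx_unit : forall x u, atlas x -> img x u -> gmx x u \in unitmx;
  gmx_transition : forall x y u, atlas x -> atlas y ->
    img x u -> dom y (param x u) ->
    let J := jacobian (coord y \o param x) u in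
    gmx x u = J *m gmx y (coord y (param x u)) *m J^T
}.

Definition christoffel (R : realType) (n : nat) (G : 'rV[R]_n -> 'M[R]_n)
    (u : 'rV[R]_n) (i j l : 'I_n) : R :=
  2^-1 * \sum_(m < n) invmx (G u) l m *
    ('D_(delta_mx 0 i) (fun v => G v j m) u
     + 'D_(delta_mx 0 j) (fun v => G v i m) u
     - 'D_(delta_mx 0 m) (fun v => G v i j) u).

Definition christoffel_form (R : realType) (n : nat) (G : 'rV[R]_n -> 'M[R]_n)
    (u X Y : 'rV[R]_n) : 'rV[R]_n :=
  \row_l \sum_(i < n) \sum_(j < n) X 0 i * Y 0 j * christoffel G u i j l.

Definition nabla (R : realType) (n : nat) (G : 'rV[R]_n -> 'M[R]_n)
    (X Y : 'rV[R]_n -> 'rV[R]_n) : 'rV[R]_n -> 'rV[R]_n :=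
  fun u => 'D_(X u) Y u + christoffel_form G u (X u) (Y u).

Definition lie_bracket (R : realType) (n : nat)
    (X Y : 'rV[R]_n -> 'rV[R]_n) : 'rV[R]_n -> 'rV[R]_n :=
  fun u => 'D_(X u) Y u - 'D_(Y u) X u.

Definition curvature_fields (R : realType) (n : nat)
    (G : 'rV[R]_n -> 'M[R]_n) (X Y Z : 'rV[R]_n -> 'rV[R]_n) :
  'rV[R]_n -> 'rV[R]_n :=
  fun u => nabla G X (nabla G Y Z) u - nabla G Y (nabla G X Z) u
           - nabla G (lie_bracket X Y) Z u.

(* By tensoriality, tangent vectors may be extended by constant components. *)
Definition curvature (R : realType) (n : nat) (G : 'rV[R]_n -> 'M[R]_n)
    (u X Y Z : 'rV[R]_n) : 'rV[R]_n :=
  curvature_fields G (cst X) (cst Y) (cst Z) u.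

Definition metric_at (R : realType) (n : nat) (M : manifold R n)
    (g : metric M) (p : M) : 'M[R]_n :=
  gmx g (chart_at p) (coord (chart_at p) p).

Definition gform (R : realType) (n : nat) (M : manifold R n)
    (g : metric M) (p : M) : form2 R n := gram (metric_at g p).

Definition curvature_at (R : realType) (n : nat) (M : manifold R n)
    (g : metric M) (p : M) (X Y Z : 'rV[R]_n) : 'rV[R]_n :=
  curvature (gmx g (chart_at p)) (coord (chart_at p) p) X Y Z.

Definition riemann (R : realType) (n : nat) (M : manifold R n)
    (g : metric M) (p : M) : form4 R n :=
  fun X1 X2 X3 X4 => gform g p (curvature_at g p X1 X2 X3) X4.

Definition ricci (R : realType) (n : nat) (M : manifold R n)
    (g : metric M) (p : M) : form2 R n :=
  fun X Y => trace (fun Z => curvature_at g p Z X Y).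

Definition scalar_curvature (R : realType) (n : nat) (M : manifold R n)
    (g : metric M) (p : M) : R := trace_g (metric_at g p) (ricci g p).

Definition weyl (R : realType) (n : nat) (M : manifold R n)
    (g : metric M) (p : M) : form4 R n :=
  riemann g p
  - (n%:R - 2)^-1 *: kulkarni_nomizu (gform g p) (ricci g p)
  + (scalar_curvature g p / (2 * (n%:R - 2) * (n%:R - 1))) *:
      kulkarni_nomizu (gform g p) (gform g p).

Definition metric_signature (R : realType) (n s : nat) (M : manifold R n)
    (g : metric M) : Prop := forall p : M, has_signature s (metric_at g p).

Definition constant_curvature (R : realType) (n : nat) (M : manifold R n)
    (g : metric M) (c : R) : Prop :=
  forall p : M,
    riemann g p = (c / 2) *: kulkarni_nomizu (gform g p) (gform g p).

Definition einstein (R : realType) (n : nat) (M : manifold R n)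
    (g : metric M) : Prop :=
  forall p : M, ricci g p = (scalar_curvature g p / n%:R) *: gform g p.

(* Vanishing of C is the notion of conformal flatness in dimension at least 4
   only. *)
Definition conformally_flat (R : realType) (n : nat) (M : manifold R n)
    (g : metric M) : Prop := forall p : M, weyl g p = 0.

Definition local_expr (R : realType) (n m : nat) (M : manifold R n)
    (N : manifold R m) (f : M -> N) (x : chart R n M) (y : chart R m N) :
  'rV[R]_n -> 'rV[R]_m := coord y \o f \o param x.

Definition local_dom (R : realType) (n m : nat) (M : manifold R n)
    (N : manifold R m) (f : M -> N) (x : chart R n M) (y : chart R m N) :
  set 'rV[R]_n := img x `&` (f \o param x) @^-1` dom y.

Definition local_at (R : realType) (n m : nat) (M : manifold R n)
    (N : manifold R m) (f : M -> N) (p : M) : 'rV[R]_n -> 'rV[R]_m :=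
  local_expr f (chart_at p) (chart_at (f p)).

(* unit_normal p is a vector of T_(f p)N. It is a choice at each point and is
   not required to depend continuously on p, so that one-sided hypersurfaces
   are included; changing its sign at p changes the sign of the second
   fundamental tensor at p. *)
Record hypersurface (R : realType) (n : nat) (M : manifold R n) (g : metric M)
    (N : manifold R n.+1) (gN : metric N) := Hypersurface {
  immersion :> M -> N;
  immersion_continuous : continuous immersion;
  immersion_smooth : forall x y, atlas x -> atlas y ->
    smooth (local_dom immersion x y) (local_expr immersion x y);
  immersion_free : forall x y u, atlas x -> atlas y ->
    local_dom immersion x y u ->
    row_free (jacobian (local_expr immersion x y) u);
  immersion_isometric : forall x y u, atlas x -> atlas y ->
    local_dom immersion x y u ->
    let J := jacobian (local_expr immersion x y) u in
    gmx g x u = J *m gmx gN y (local_expr immersion x y u) *m J^T;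
  normal_sign : R;
  normal_signP : normal_sign = 1 \/ normal_sign = -1;
  unit_normal : M -> 'rV[R]_n.+1;
  unit_normal_unit : forall p,
    gform gN (immersion p) (unit_normal p) (unit_normal p) = normal_sign;
  unit_normal_orthogonal : forall p (X : 'rV[R]_n),
    gform gN (immersion p)
      ('D_X (local_at immersion p) (coord (chart_at p) p)) (unit_normal p) = 0
}.

(* Covariant derivative along F of the field W along F, in the direction X. *)
Definition nabla_along (R : realType) (n m : nat) (G : 'rV[R]_m -> 'M[R]_m)
    (F : 'rV[R]_n -> 'rV[R]_m) (X : 'rV[R]_n) (W : 'rV[R]_n -> 'rV[R]_m) :
  'rV[R]_n -> 'rV[R]_m :=
  fun u => 'D_X W u + christoffel_form G (F u) ('D_X F u) (W u).

(* With xi the unit normal, eps = g(xi, xi), and D, D' the Levi-Civita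
   connections of M and of the ambient space, the Gauss formula
   D'_X Y = D_X Y + eps * H(X, Y) * xi gives H(X, Y) = g(D'_X Y, xi);
   here Y is extended with constant components. *)
Definition second_fundamental (R : realType) (n : nat) (M : manifold R n)
    (g : metric M) (N : manifold R n.+1) (gN : metric N)
    (f : hypersurface g gN) (p : M) : form2 R n :=
  fun X Y =>
    let F := local_at f p in
    gform gN (f p)
      (nabla_along (gmx gN (chart_at (f p))) F X (fun u => 'D_Y F u)
         (coord (chart_at p) p))
      (unit_normal f p).

Definition second_fundamental2 (R : realType) (n : nat) (M : manifold R n)
    (g : metric M) (N : manifold R n.+1) (gN : metric N)
    (f : hypersurface g gN) (p : M) : form2 R n :=
  fmul (metric_at g p) (second_fundamental f p) (second_fundamental f p).

Definition second_fundamental3 (R : realType) (n : nat) (M : manifold R n)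
    (g : metric M) (N : manifold R n.+1) (gN : metric N)
    (f : hypersurface g gN) (p : M) : form2 R n :=
  fmul (metric_at g p) (second_fundamental2 f p) (second_fundamental f p).

Definition UH (R : realType) (n : nat) (M : manifold R n)
    (g : metric M) (N : manifold R n.+1) (gN : metric N)
    (f : hypersurface g gN) : set M :=
  [set p | ~ exists a b : R, second_fundamental2 f p =
                             a *: gform g p + b *: second_fundamental f p].

Definition ricci2 (R : realType) (n : nat) (M : manifold R n)
    (g : metric M) (p : M) : form2 R n :=
  fmul (metric_at g p) (ricci g p) (ricci g p).

Definition Etensor (R : realType) (n : nat) (M : manifold R n)
    (g : metric M) (p : M) : form4 R n :=
  let k := scalar_curvature g p in
  kulkarni_nomizu (gform g p) (ricci2 g p)
  + ((n%:R - 2) / 2) *: kulkarni_nomizu (ricci g p) (ricci g p)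
  - k *: kulkarni_nomizu (gform g p) (ricci g p)
  + ((k ^+ 2 - trace_g (metric_at g p) (ricci2 g p)) / (2 * (n%:R - 1))) *:
      kulkarni_nomizu (gform g p) (gform g p).

(* Main.v *)
Require Import Defs.
From HB Require Import structures.
From mathcomp Require Import all_boot all_order all_algebra.
From mathcomp Require Import all_classical all_reals all_analysis.
From mathcomp Require Import ring lra.
Set Implicit Arguments.
Unset Strict Implicit.
Unset Printing Implicit Defensive.
Import Order.TTheory GRing.Theory Num.Theory.
Import numFieldNormedType.Exports.
Local Open Scope classical_set_scope.
Local Open Scope ring_scope.

(** Let A = tr(H) H - H^2. The Gauss equation gives S = (n-1)c g + eps A and
    eps C = (1/2) H /\ H - 1/(n-2) g /\ A + b/(2(n-1)(n-2)) g /\ g with b = tr(A), where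
    /\ is the Kulkarni-Nomizu product. For the associated endomorphisms, the
    relation H^3 = tr(H) H^2 + psi H reads HA = AH = - psi H, hence
    A^2 = - psi A; this makes C.C a polynomial identity in the values of g, H
    and A, which is (i).  As Q(S - ..., R - ...) is affine in rho with slope
    Q(g, C), replacing rho by tau absorbs L_C Q(g, C).  Then, with
    B = A + (eps tau) g, the generalized curvature tensor
    T = (1/2) H /\ H + eps tau/(2(n-2)) g /\ g satisfies Q(B, T) = 0, so that either
    B /\ B = 0 or T is a multiple of B /\ B.  Comparing the Ricci contractions of
    these relations shows that E = 0 in the first case, and that C is a nonzero
    multiple of E in the second.

    The Gauss equation itself comes from the formula for the curvature along a
    map F in terms of the derivatives of G(D_Y F_Z, F_T), with F_Z the derivative
    of F along Z, applied both to the immersion in charts and to the identity of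
    M: these derivatives agree, and only the difference of the quadratic terms
    remains. *)

(** * Bilinear forms and curvature-like tensors *)

Lemma linear_form_sum (R : realType) n (f : 'rV[R]_n -> R) X :
  (forall a X Y, f (a *: X + Y) = a * f X + f Y) ->
  f X = \sum_i X 0 i * f (delta_mx 0 i).
Proof.
move=> fl; have f0 : f 0 = 0.
  by have := fl 1 0 0; rewrite scaler0 addr0 mul1r => h; lra.
rewrite {1}(row_sum_delta X); elim/big_ind2 : _ => [|x a y b xa yb|i _] //.
  by rewrite -[a in f (a + _)](scale1r a) fl mul1r xa yb.
by rewrite -[_ *: _]addr0 fl f0 addr0.
Qed.

Section Forms.
Context {R : realType} {n : nat}.
Implicit Types (T : form4 R n) (A : form2 R n).

Lemma form2P A B : (forall X Y, A X Y = B X Y) -> A = B.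
Proof. by move=> AB; apply/funext => X; apply/funext => Y. Qed.

Lemma form4P T T' :
  (forall X1 X2 X3 X4, T X1 X2 X3 X4 = T' X1 X2 X3 X4) -> T = T'.
Proof.
by move=> TT; apply/funext => ?; apply/funext => ?; apply: form2P => *; exact: TT.
Qed.

Lemma form6P (T T' : form6 R n) :
  (forall X1 X2 X3 X4 X Y, T X1 X2 X3 X4 X Y = T' X1 X2 X3 X4 X Y) -> T = T'.
Proof.
by move=> TT; apply/funext => ?; apply/funext => ?; apply: form4P => *; exact: TT.
Qed.

Lemma form4D T T' X1 X2 X3 X4 : (T + T') X1 X2 X3 X4 = T X1 X2 X3 X4 + T' X1 X2 X3 X4.
Proof. by []. Qed.
Lemma form4N T X1 X2 X3 X4 : (- T) X1 X2 X3 X4 = - T X1 X2 X3 X4.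
Proof. by []. Qed.
Lemma form4Z a T X1 X2 X3 X4 : (a *: T) X1 X2 X3 X4 = a * T X1 X2 X3 X4.
Proof. by []. Qed.
Definition form4E := (form4D, form4N, form4Z).

Lemma form2D A B X Y : (A + B) X Y = A X Y + B X Y.
Proof. by []. Qed.
Lemma form2N A X Y : (- A) X Y = - A X Y.
Proof. by []. Qed.
Lemma form2Z a A X Y : (a *: A) X Y = a * A X Y.
Proof. by []. Qed.
Definition form2E := (form2D, form2N, form2Z).

Lemma form6Z a (T : form6 R n) X1 X2 X3 X4 X Y :
  (a *: T) X1 X2 X3 X4 X Y = a * T X1 X2 X3 X4 X Y.
Proof. by []. Qed.

End Forms.

(** * Bilinear forms given by matrices, and raising of indices *)

Section Gram.
Context {R : realType} {n : nat}.
Implicit Types (A B G : 'M[R]_n) (X Y Z : 'rV[R]_n).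

Lemma gram_mxD A B : gram (A + B) = gram A + gram B.
Proof. by apply: form2P => X Y; rewrite /gram mulmxDr mulmxDl mxE. Qed.

Lemma gram_mxZ a A : gram (a *: A) = a *: gram A.
Proof.
by apply: form2P => X Y; rewrite /gram -scalemxAr -scalemxAl mxE.
Qed.

Lemma gram_mxN A : gram (- A) = - gram A.
Proof. by rewrite -scaleN1r gram_mxZ scaleN1r. Qed.

Lemma gramDl A X Y Z : gram A (X + Y) Z = gram A X Z + gram A Y Z.
Proof. by rewrite /gram !mulmxDl mxE. Qed.

Lemma gramZl A a X Z : gram A (a *: X) Z = a * gram A X Z.
Proof. by rewrite /gram -!scalemxAl mxE. Qed.

Lemma gramNl A X Z : gram A (- X) Z = - gram A X Z.
Proof. by rewrite /gram !mulNmx mxE. Qed.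

Lemma gramDr A X Y Z : gram A Z (X + Y) = gram A Z X + gram A Z Y.
Proof. by rewrite /gram linearD mulmxDr mxE. Qed.

Lemma gramZr A a X Z : gram A Z (a *: X) = a * gram A Z X.
Proof. by rewrite /gram linearZ -scalemxAr mxE. Qed.

Lemma gramNr A X Z : gram A Z (- X) = - gram A Z X.
Proof. by rewrite /gram linearN mulmxN mxE. Qed.

Lemma gram0l A X : gram A 0 X = 0.
Proof. by rewrite /gram !mul0mx mxE. Qed.

Lemma gram0r A X : gram A X 0 = 0.
Proof. by rewrite /gram trmx0 mulmx0 mxE. Qed.

Lemma gram_combl A a b X Y Z :
  gram A (a *: X - b *: Y) Z = a * gram A X Z - b * gram A Y Z.
Proof. by rewrite gramDl gramNl !gramZl. Qed.

Lemma gram_combr A a b X Y Z :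
  gram A Z (a *: X - b *: Y) = a * gram A Z X - b * gram A Z Y.
Proof. by rewrite gramDr gramNr !gramZr. Qed.

Lemma gramC A X Y : A^T = A -> gram A X Y = gram A Y X.
Proof.
move=> As; have -> : gram A X Y = (Y *m A *m X^T)^T 0 0.
  by rewrite !trmx_mul trmxK As mulmxA.
by rewrite mxE.
Qed.

Lemma gram_delta A i j : gram A (delta_mx 0 i) (delta_mx 0 j) = A i j.
Proof. by rewrite /gram -rowE trmx_delta -colE !mxE. Qed.

Lemma gram_sum A X Y : gram A X Y = \sum_i \sum_j X 0 i * Y 0 j * A i j.
Proof.
rewrite (linear_form_sum (f := gram A ^~ Y)) => [|a ? ?]; last by rewrite gramDl gramZl.
apply: eq_bigr => i _; rewrite (linear_form_sum (f := gram A _)) => [|a ? ?].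
  by rewrite mulr_sumr; apply: eq_bigr => j _; rewrite gram_delta mulrA.
by rewrite gramDr gramZr.
Qed.

Lemma gram_inj A B : gram A = gram B -> A = B.
Proof. by move=> e; apply/matrixP => i j; rewrite -!gram_delta e. Qed.

Lemma gram_mull A B X Y : gram A (X *m B) Y = gram (B *m A) X Y.
Proof. by rewrite /gram !mulmxA. Qed.

(** The values of [a] on the standard basis are the entries of [X *m G]; inverting [G] recovers
    [X]. *)
Lemma sharp_unique G a X : G \in unitmx ->
  (forall Y, a Y = gram G X Y) -> sharp G a = X.
Proof.
move=> Gu aE; rewrite /sharp -[RHS](mulmxK Gu); congr (_ *m _).
by apply/rowP => j; rewrite mxE aE /gram trmx_delta -colE mxE.
Qed.

Lemma endo_gram G A X : G \in unitmx -> endo G (gram A) X = X *m (A *m invmx G).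
Proof.
move=> Gu; apply: sharp_unique => // Y.
by rewrite gram_mull -mulmxA mulVmx // mulmx1.
Qed.

Lemma fmul_gram G A B : G \in unitmx ->
  fmul G (gram A) (gram B) = gram (B *m invmx G *m A).
Proof.
move=> Gu; apply: form2P => X Y.
by rewrite /fmul endo_gram // gram_mull.
Qed.

Lemma trace_mul A : trace (fun X => X *m A) = \tr A.
Proof. by apply: eq_bigr => i _; rewrite -rowE mxE. Qed.

Lemma trace_g_gram G A : G \in unitmx ->
  trace_g G (gram A) = \tr (A *m invmx G).
Proof.
by move=> Gu; rewrite -trace_mul; apply: eq_bigr => i _; rewrite endo_gram.
Qed.

Definition form_mx (A : form2 R n) : 'M[R]_n :=
  \matrix_(i, j) A (delta_mx 0 i) (delta_mx 0 j).

(** Symmetry carries linearity from the first slot to the second. This turns the second fundamental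
    tensor, defined as a function of vectors, into a matrix. *)
Lemma form_mxK (A : form2 R n) :
  (forall a X Y Z, A (a *: X + Y) Z = a * A X Z + A Y Z) ->
  (forall X Y, A X Y = A Y X) -> A = gram (form_mx A).
Proof.
move=> Al As; have Asum X Z : A X Z = \sum_i X 0 i * A (delta_mx 0 i) Z.
  exact: (linear_form_sum (f := A ^~ Z)).
apply: form2P => X Y.
rewrite Asum /gram mxE; under [RHS]eq_bigr => j _ do rewrite !mxE mulr_suml.
rewrite exchange_big; apply: eq_bigr => i _ /=.
rewrite As Asum mulr_sumr; apply: eq_bigr => j _.
by rewrite mxE As mulrA mulrAC.
Qed.
End Gram.

(** * Generalized curvature tensors and the equation Q(B, T) = 0 *)

Section CurvatureLike.
Context {R : realType} {n : nat}.
Implicit Types (T : form4 R n) (B : 'M[R]_n).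

(** Linearity is asked of the first slot only; skew-symmetry and pair symmetry carry it to the other
    three. *)
Definition curvature_like T := [/\
  forall a X Y X2 X3 X4, T (a *: X + Y) X2 X3 X4 = a * T X X2 X3 X4 + T Y X2 X3 X4,
  forall X1 X2 X3 X4, T X2 X1 X3 X4 = - T X1 X2 X3 X4,
  forall X1 X2 X3 X4, T X3 X4 X1 X2 = T X1 X2 X3 X4
  & forall X1 X2 X3 X4, T X1 X2 X3 X4 + T X2 X3 X1 X4 + T X3 X1 X2 X4 = 0].

Lemma curvature_like_comb a T b T' : curvature_like T -> curvature_like T' ->
  curvature_like (a *: T + b *: T').
Proof.
move=> [l1 a1 p1 b1] [l2 a2 p2 b2].
have E X1 X2 X3 X4 : (a *: T + b *: T') X1 X2 X3 X4 = a * T X1 X2 X3 X4 + b * T' X1 X2 X3 X4 by [].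
split=> [x X Y X2 X3 X4|X1 X2 X3 X4|X1 X2 X3 X4|X1 X2 X3 X4]; rewrite !E.
- by rewrite l1 l2; ring.
- by rewrite a1 a2; ring.
- by rewrite p1 p2.
- move: (b1 X1 X2 X3 X4) (b2 X1 X2 X3 X4) => h1 h2.
  transitivity (a * (T X1 X2 X3 X4 + T X2 X3 X1 X4 + T X3 X1 X2 X4)
    + b * (T' X1 X2 X3 X4 + T' X2 X3 X1 X4 + T' X3 X1 X2 X4)); first ring.
  by rewrite h1 h2; ring.
Qed.

Lemma curvature_like_KN B : B^T = B -> curvature_like (kulkarni_nomizu (gram B) (gram B)).
Proof.
move=> Bs; have s U V : gram B U V = gram B V U by apply: gramC.
rewrite /kulkarni_nomizu; split=> [x X Y X2 X3 X4|X1 X2 X3 X4|X1 X2 X3 X4|X1 X2 X3 X4].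
- by rewrite !(gramDl, gramZl); ring.
- by ring.
- by rewrite [gram B X3 X2]s [gram B X4 X1]s [gram B X3 X1]s [gram B X4 X2]s; ring.
- by rewrite [gram B X2 X1]s [gram B X3 X2]s [gram B X3 X1]s; ring.
Qed.

(** Each endomorphism Z -> B(Y, Z) X - B(X, Z) Y is skew for B, so the derivation it induces kills
    B, hence also B /\ B. *)
Lemma tachibana_KN B X1 X2 X3 X4 X Y : B^T = B ->
  tachibana (gram B) (kulkarni_nomizu (gram B) (gram B)) X1 X2 X3 X4 X Y = 0.
Proof.
move=> Bs; have s U V : gram B U V = gram B V U by apply: gramC.
rewrite /tachibana /derivation4 /kulkarni_nomizu !(gram_combl, gram_combr).
rewrite [gram B X X1]s [gram B X X2]s [gram B X X3]s [gram B X X4]s.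
rewrite [gram B Y X1]s [gram B Y X2]s [gram B Y X3]s [gram B Y X4]s; ring.
Qed.

(** The equation Q(B, T) = 0 in the directions u, Y recovers T from its components with u in one
    slot, and these from the form Phi X Y = T u X Y u. The second vector v then forces Phi = 0. *)
Lemma tachibana_eq0_null B T u v : B^T = B -> curvature_like T ->
  (forall X1 X2 X3 X4 X Y, tachibana (gram B) T X1 X2 X3 X4 X Y = 0) ->
  gram B u u != 0 -> gram B v v != 0 -> gram B u v = 0 -> T u v v u = 0 -> T = 0.
Proof.
move=> Bs [T1 Ta Tp Tb] TQ pn qn uv Tuv.
have s U V : gram B U V = gram B V U by apply: gramC.
have vu : gram B v u = 0 by rewrite s.
have T1' a b X Y X2 X3 X4 :
    T (a *: X - b *: Y) X2 X3 X4 = a * T X X2 X3 X4 - b * T Y X2 X3 X4.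
  rewrite T1 -[- (b *: Y)]addr0 -scaleNr T1.
  have -> : T 0 X2 X3 X4 = 0.
    by have := T1 1 0 0 X2 X3 X4; rewrite scaler0 addr0 mul1r => h; clear -h; lra.
  ring.
have T2' a b X Y X1 X3 X4 :
    T X1 (a *: X - b *: Y) X3 X4 = a * T X1 X X3 X4 - b * T X1 Y X3 X4.
  by rewrite Ta T1' (Ta X1 X) (Ta X1 Y); ring.
have T3' a b X Y X1 X2 X4 :
    T X1 X2 (a *: X - b *: Y) X4 = a * T X1 X2 X X4 - b * T X1 X2 Y X4.
  by rewrite Tp T1' !(Tp X1 X2).
have T4' a b X Y X1 X2 X3 :
    T X1 X2 X3 (a *: X - b *: Y) = a * T X1 X2 X3 X - b * T X1 X2 X3 Y.
  by rewrite Tp T2' !(Tp X1 X2).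
set p := gram B u u in pn.
have Taa X Y Z : T X X Y Z = 0 by move: (Ta X X Y Z) => h; clear -h; lra.
have Tbb X Y Z : T Y Z X X = 0 by rewrite Tp Taa.
(* With u also in the first slot, the derivation sends u to B(Y, u) u - p Y, which isolates p T Y X2
   X3 X4. *)
have E Y X2 X3 X4 : p * T Y X2 X3 X4 =
   gram B Y u * T u X2 X3 X4 - gram B u X2 * T u Y X3 X4
   + gram B Y X3 * T u X2 u X4 - gram B u X3 * T u X2 Y X4
   + gram B Y X4 * T u X2 X3 u - gram B u X4 * T u X2 X3 Y.
  have := TQ u X2 X3 X4 u Y; rewrite /tachibana /derivation4 !(T1', T2', T3', T4') Taa -/p.
  by move=> h; clear -h; lra.
have Td X1 X2 X3 X4 : T X1 X2 X4 X3 = - T X1 X2 X3 X4 by rewrite Tp Ta Tp.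
have flip X1 X2 X3 X4 : T X4 X3 X2 X1 = T X1 X2 X3 X4 by rewrite Tp Ta Td opprK.
pose Phi X Y := T u X Y u.
have PhiC X Y : Phi X Y = Phi Y X by rewrite /Phi flip.
have Psi2 a b d : p * (T a b d u + T a d b u) =
    2 * gram B u a * Phi b d - gram B u b * Phi a d - gram B u d * Phi b a.
  have := E a b d u; rewrite Tbb -/(Phi b d) -/(Phi a d) -/(Phi b a) -/p (s a u).
  by rewrite -(flip u b d a); move=> h; clear -h; lra.
(* The symmetrization of [T a _ _ u] is known from Psi2; the Bianchi identity
   then determines [T a b d u]. *)
have Psi a b d : p * T a b d u = gram B u a * Phi b d - gram B u b * Phi a d.
  move: (Psi2 a b d) (Psi2 b a d) (congr1 (GRing.mul p) (Tb a b d u)).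
  rewrite (PhiC b a) (Ta a b) (Ta a d) => h1 h2 h3; clear -h1 h2 h3; lra.
have zero x : p * x = 0 -> x = 0 by move/eqP; rewrite mulf_eq0 (negbTE pn) => /eqP.
have Tuvv a : T u v v a = 0.
  rewrite -flip; apply: zero.
  by rewrite Psi uv /Phi Tuv !mulr0 mul0r subr0.
(* [E] expands T Y v v X in two ways, from Y and, after exchanging pairs, from v; the two results
   differ by B(v, v) Phi X Y. *)
have Phi0 X Y : Phi X Y = 0.
  have := E Y v v X; rewrite (Tp v X Y v) (E v X Y v) vu uv !Tuvv Tbb
    (Td u v v Y) Tuvv -/(Phi X Y) (Tp u X u v).
  rewrite (s v Y) !(mul0r, mulr0, oppr0, addr0, add0r, subr0) => h.
  have : gram B v v * Phi X Y = 0 by clear -h; lra.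
  by move/eqP; rewrite mulf_eq0 (negbTE qn) => /eqP.
have Psi0 a b d : T a b d u = 0 by apply: zero; rewrite Psi !Phi0; ring.
have T0 a b d : T u a b d = 0 by rewrite -flip Psi0.
apply: form4P => X1 X2 X3 X4.
by apply: zero; rewrite E !T0; ring.
Qed.

(** A form of rank at most one satisfies B /\ B = 0. Without a vector u with B(u, u) nonzero,
    polarization gives B = 0; without a suitable v, B vanishes on the B-orthogonal complement of u
    and so has rank one. *)
Lemma exists_null_basis B : B^T = B ->
  kulkarni_nomizu (gram B) (gram B) <> 0 ->
  exists u v, [/\ gram B u u != 0, gram B v v != 0 & gram B u v = 0].
Proof.
move=> Bs Bn; have s U V : gram B U V = gram B V U by apply: gramC.
have KN0 (f : 'rV[R]_n -> R) (a : R) : (forall X Y, a * gram B X Y = f X * f Y) -> a != 0 ->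
    kulkarni_nomizu (gram B) (gram B) = 0.
  move=> Bf an; have {}Bf X Y : gram B X Y = a^-1 * (f X * f Y) by rewrite -Bf mulKf.
  apply: form4P => X1 X2 X3 X4.
  by rewrite /kulkarni_nomizu !Bf; transitivity (0 : R); [ring|].
have [[u pn]|u0] := pselect (exists u, gram B u u != 0); last first.
  case: Bn; apply: (KN0 (fun=> 0) 1) => [X Y|]; last exact: oner_neq0.
  have q0 Z : gram B Z Z = 0 by apply/eqP/negPn/negP => h; apply: u0; exists Z.
  move: (q0 (X + Y)); rewrite !(gramDl, gramDr) !q0 (s Y X) => h; clear -h; lra.
exists u.
have [[v [qn uv]]|v0] := pselect (exists v, gram B v v != 0 /\ gram B u v = 0).
  by exists v.
case: Bn; apply: (KN0 (gram B u) (gram B u u)) => // X Y.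
(* The B-orthogonal projection along u, multiplied by B(u, u) to avoid a division. *)
pose P Z := gram B u u *: Z - gram B u Z *: u.
have uP Z : gram B u (P Z) = 0 by rewrite /P gramDr gramNr !gramZr; ring.
have q0 Z : gram B (P Z) (P Z) = 0.
  by apply/eqP/negPn/negP => h; apply: v0; exists (P Z).
have q2 : gram B (P X) (P Y) = 0.
  have := q0 (X + Y); have -> : P (X + Y) = P X + P Y.
    by rewrite /P gramDr scalerDr scalerDl opprD addrACA.
  by rewrite (gramDl B (P X) (P Y)) !(gramDr B (P X) (P Y)) !q0 (s (P Y)) => h; clear -h; lra.
have : gram B u u * (gram B u u * gram B X Y - gram B u X * gram B u Y) = 0.
  by rewrite -q2 /P !(gramDl, gramNl, gramZl, gramDr, gramNr, gramZr) (s X u); ring.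
by move/eqP; rewrite mulf_eq0 (negbTE pn) /= subr_eq0 => /eqP.
Qed.

(** Subtracting a multiple of B /\ B, which Q(B, -) kills, makes the component at u, v, v, u vanish,
    and [tachibana_eq0_null] applies. *)
Lemma tachibana_eq0 B T : B^T = B -> curvature_like T ->
  (forall X1 X2 X3 X4 X Y, tachibana (gram B) T X1 X2 X3 X4 X Y = 0) ->
  kulkarni_nomizu (gram B) (gram B) <> 0 ->
  exists l, T = l *: kulkarni_nomizu (gram B) (gram B).
Proof.
move=> Bs Tc TQ /(exists_null_basis Bs)[u [v [pn qn uv]]].
set K := kulkarni_nomizu _ _.
(* As B(u, v) = 0, the component of B /\ B at u, v, v, u is 2 B(u, u) B(v, v). *)
exists (T u v v u / (2 * gram B u u * gram B v v)); set l := _ / _.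
have E X1 X2 X3 X4 : (1 *: T + (- l) *: K) X1 X2 X3 X4 = 1 * T X1 X2 X3 X4 - l * K X1 X2 X3 X4.
  by rewrite -(mulNr l (K _ _ _ _)).
apply/eqP; rewrite -subr_eq0 -[X in X - _]scale1r -scaleNr; apply/eqP.
apply: (tachibana_eq0_null Bs _ _ pn qn uv).
- exact: curvature_like_comb (curvature_like_KN Bs).
- move=> X1 X2 X3 X4 X Y.
  transitivity (tachibana (gram B) T X1 X2 X3 X4 X Y - l * tachibana (gram B) K X1 X2 X3 X4 X Y).
    by rewrite /tachibana /derivation4 !E; ring.
  by rewrite TQ tachibana_KN // mulr0 subr0.
- rewrite E /K /kulkarni_nomizu (gramC v u Bs) uv /l; field.
  by rewrite pn qn.
Qed.
End CurvatureLike.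

(** * Pointwise algebra of the Weyl tensor of a hypersurface *)

(* For s : forall U V, a U V = a V U, orders the arguments of a as
   X1, X2, X3, X4, X, Y. *)
Ltac orient s X1 X2 X3 X4 X Y :=
  rewrite ?(s X2 X1) ?(s X3 X1) ?(s X4 X1) ?(s X X1) ?(s Y X1)
    ?(s X3 X2) ?(s X4 X2) ?(s X X2) ?(s Y X2)
    ?(s X4 X3) ?(s X X3) ?(s Y X3) ?(s X X4) ?(s Y X4) ?(s Y X).

Section Pointwise.
Context {R : realType} {n : nat}.
Context (hn : (4 <= n)%N) (G H : 'M[R]_n) (eps c psi : R).
Context (Gs : G^T = G) (Gu : G \in unitmx) (Hs : H^T = H) (eps2 : eps ^+ 2 = 1).
Let t := \tr (H *m invmx G).
Let H2 := H *m invmx G *m H.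
Context (H3E : H *m invmx G *m H2 = t *: H2 + psi *: H).
Let A := t *: H - H2.
Let b := \tr (A *m invmx G).
Let nR : R := n%:R.

Lemma eps_cases : eps = 1 \/ eps = -1.
Proof.
by move/eqP: eps2; rewrite sqrf_eq1 => /orP[] /eqP; [left|right].
Qed.

Lemma natr_gt3 : 3 < nR.
Proof. by rewrite /nR (ltr_nat R 3 n). Qed.

Lemma natr_sub_neq0 : [/\ nR - 1 != 0, nR - 2 != 0 & nR - 3 != 0].
Proof.
have n3 := natr_gt3.
split; rewrite subr_eq0 gt_eqF //; apply: le_lt_trans n3; rewrite ?ler1n //.
by rewrite ler_nat.
Qed.

Lemma tr_invmx_sym : (invmx G)^T = invmx G.
Proof. by rewrite trmx_inv Gs. Qed.

Lemma H2_sym : H2^T = H2.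
Proof. by rewrite /H2 !trmx_mul Hs tr_invmx_sym mulmxA. Qed.

Lemma A_sym : A^T = A.
Proof. by rewrite /A linearB linearZ /= H2_sym Hs. Qed.

Lemma mulHA : H *m invmx G *m A = - psi *: H.
Proof.
by rewrite /A mulmxBr H3E -scalemxAr -/H2 opprD addrA subrr sub0r scaleNr.
Qed.

Lemma mulAH : A *m invmx G *m H = - psi *: H.
Proof.
by apply: trmx_inj; rewrite !trmx_mul Hs tr_invmx_sym A_sym mulmxA mulHA linearZ /= Hs.
Qed.

Lemma mulAA : A *m invmx G *m A = - psi *: A.
Proof.
have H2A : H2 *m invmx G *m A = - psi *: H2.
  by rewrite {1}/H2 -!mulmxA [H *m (invmx G *m A)]mulmxA mulHA -!scalemxAr mulmxA.
by rewrite {1}/A mulmxBl mulmxBl -!scalemxAl mulHA H2A scalerA mulrC -scalerA -scalerBr.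
Qed.

(** This is eps C, see [weylE]; neither c nor eps occurs in it. *)
Definition weyl0 : form4 R n := fun X1 X2 X3 X4 =>
  let g := gram G in let h := gram H in let a := gram A in
  h X1 X4 * h X2 X3 - h X1 X3 * h X2 X4
  - (nR - 2)^-1 * (g X1 X4 * a X2 X3 + g X2 X3 * a X1 X4 - g X1 X3 * a X2 X4 - g X2 X4 * a X1 X3)
  + b / ((nR - 1) * (nR - 2)) * (g X1 X4 * g X2 X3 - g X1 X3 * g X2 X4).

(** The endomorphism obtained from [weyl0] by raising the last slot. In this explicit form,
    composing it with H or A only needs [mulAH], [mulHA] and [mulAA]. *)
Definition weyl0_op X1 X2 X3 : 'rV[R]_n :=
  let g := gram G in let h := gram H in let a := gram A in
  h X2 X3 *: (X1 *m (H *m invmx G)) - h X1 X3 *: (X2 *m (H *m invmx G))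
  - (nR - 2)^-1 *: (a X2 X3 *: X1 + g X2 X3 *: (X1 *m (A *m invmx G))
                    - g X1 X3 *: (X2 *m (A *m invmx G)) - a X1 X3 *: X2)
  + (b / ((nR - 1) * (nR - 2))) *: (g X2 X3 *: X1 - g X1 X3 *: X2).

Lemma gram_endo B P X Y :
  gram P (X *m (B *m invmx G)) Y = gram (B *m invmx G *m P) X Y.
Proof. by rewrite gram_mull. Qed.

Lemma weyl0_opE X1 X2 X3 X4 : weyl0 X1 X2 X3 X4 = gram G (weyl0_op X1 X2 X3) X4.
Proof.
rewrite /weyl0_op !(gramDl, gramNl, gramZl, gram_endo) -2!mulmxA !mulVmx // !mulmx1.
rewrite /weyl0; ring.
Qed.

Lemma sharp_weyl0 X1 X2 X3 :
  sharp G ((eps *: weyl0) X1 X2 X3) = eps *: weyl0_op X1 X2 X3.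
Proof.
by apply: sharp_unique => // Y; rewrite form4Z gramZl weyl0_opE.
Qed.

(** The Ricci tensor and scalar curvature that the Gauss equation yields, as shown in
    [ricci_hypersurface] and [scalar_hypersurface]. *)
Let ric := gram (((nR - 1) * c) *: G + eps *: A).
Let kap := nR * (nR - 1) * c + eps * b.
Context (riem : form4 R n).
Context (riemE : forall X1 X2 X3 X4, riem X1 X2 X3 X4 =
   c * (gram G X1 X4 * gram G X2 X3 - gram G X1 X3 * gram G X2 X4)
   + eps * (gram H X1 X4 * gram H X2 X3 - gram H X1 X3 * gram H X2 X4)).

Let C : form4 R n :=
  riem - (nR - 2)^-1 *: kulkarni_nomizu (gram G) ric
  + (kap / (2 * (nR - 2) * (nR - 1))) *: kulkarni_nomizu (gram G) (gram G).

Lemma weylE : C = eps *: weyl0.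
Proof.
apply: form4P => X1 X2 X3 X4.
rewrite /C /ric gram_mxD !gram_mxZ !form4E /kulkarni_nomizu !form2E riemE /weyl0 /kap.
by have [n1 n2 n3] := natr_sub_neq0; field; rewrite n1 n2.
Qed.

(** This is eps rho, once the ambient scalar curvature is replaced by n(n+1)c. *)
Let rho0 := (nR - 3)^-1 * (b / (nR - 1) + psi).

Let Q (s : R) : form6 R n := tachibana (gram (A + s *: G))
  (2^-1 *: kulkarni_nomizu (gram H) (gram H)
   + (s / (2 * (nR - 2))) *: kulkarni_nomizu (gram G) (gram G)).

Lemma weyl_dot_weyl X1 X2 X3 X4 X Y :
  tdot G C C X1 X2 X3 X4 X Y =
  (nR - 3) / (nR - 2) * Q rho0 X1 X2 X3 X4 X Y.
Proof.
rewrite /Q weylE /tdot /derivation4 !sharp_weyl0 /tachibana /derivation4.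
rewrite gram_mxD gram_mxZ !form4E /kulkarni_nomizu !form2E.
have gs U V : gram G U V = gram G V U by apply: gramC Gs.
have hs U V : gram H U V = gram H V U by apply: gramC Hs.
have As U V : gram A U V = gram A V U by apply: gramC A_sym.
have H2E : H2 = t *: H - A by rewrite /A opprB addrC subrK.
(* The cubic relation closes the computation: composing the operator with H, A or G produces values
   of g, h and a only. *)
have hop U V W Z : gram H (weyl0_op U V W) Z =
  gram H V W * (t * gram H U Z - gram A U Z) - gram H U W * (t * gram H V Z - gram A V Z)
  - (nR - 2)^-1 * (gram A V W * gram H U Z - psi * gram G V W * gram H U Z
                   + psi * gram G U W * gram H V Z - gram A U W * gram H V Z)
  + (b / ((nR - 1) * (nR - 2))) * (gram G V W * gram H U Z - gram G U W * gram H V Z).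
  rewrite /weyl0_op !(gramDl, gramNl, gramZl, gram_endo) mulAH -/H2 H2E.
  rewrite !(gram_mxD, gram_mxN, gram_mxZ) !form2E; ring.
have aop U V W Z : gram A (weyl0_op U V W) Z =
  - psi * (gram H V W * gram H U Z - gram H U W * gram H V Z)
  - (nR - 2)^-1 * (gram A V W * gram A U Z - psi * gram G V W * gram A U Z
                   + psi * gram G U W * gram A V Z - gram A U W * gram A V Z)
  + (b / ((nR - 1) * (nR - 2))) * (gram G V W * gram A U Z - gram G U W * gram A V Z).
  rewrite /weyl0_op !(gramDl, gramNl, gramZl, gram_endo) mulHA mulAA.
  rewrite !(gram_mxD, gram_mxZ) !form2E; ring.
have gop U V W Z : gram G (weyl0_op U V W) Z = weyl0 U V W Z by rewrite weyl0_opE.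
move: weyl0_op hop aop gop => op hop aop gop.
have gopr U V W Z : gram G Z (op U V W) = gram G (op U V W) Z by exact: gs.
have hopr U V W Z : gram H Z (op U V W) = gram H (op U V W) Z by exact: hs.
have aopr U V W Z : gram A Z (op U V W) = gram A (op U V W) Z by exact: As.
rewrite /weyl0 !(gram_combl, gram_combr, gramZl, gramZr).
rewrite !(gopr, hopr, aopr) !(hop, aop, gop) /weyl0.
orient gs X1 X2 X3 X4 X Y.
orient hs X1 X2 X3 X4 X Y.
orient As X1 X2 X3 X4 X Y.
have [n1 n2 n3] := natr_sub_neq0.
(* All dependence on n and b is expressed through v = 1/(n-2) and r = rho0, which leaves a
   polynomial identity. *)
have -> : rho0 / (2 * (nR - 2)) = rho0 * (nR - 2)^-1 / 2 by field.
have -> : (nR - 3) / (nR - 2) = 1 - (nR - 2)^-1 by field.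
have -> : b / ((nR - 1) * (nR - 2)) = (1 - (nR - 2)^-1) * rho0 - (nR - 2)^-1 * psi.
  by rewrite /rho0; field; rewrite n1 n2 n3.
move: (nR - 2)^-1 rho0 => v r; move: (gram G) (gram H) (gram A) => g h a.
by have [->|->] := eps_cases; field.
Qed.

(** The quadratic term in s is a multiple of Q(g, g /\ g) = 0. Polarizing Q(B, B /\ B) = 0 gives
    Q(A, g /\ g) = - 2 Q(g, g /\ A), so the linear term is Q(g, eps C). *)
Lemma tachibana_shift s r X1 X2 X3 X4 X Y :
  Q s X1 X2 X3 X4 X Y =
  Q r X1 X2 X3 X4 X Y + (s - r) * tachibana (gram G) weyl0 X1 X2 X3 X4 X Y.
Proof.
rewrite /Q /tachibana /derivation4 !(gram_mxD A) !(gram_mxZ _ G) !form4E.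
rewrite /kulkarni_nomizu !form2E /weyl0.
have gs U V : gram G U V = gram G V U by apply: gramC Gs.
have hs U V : gram H U V = gram H V U by apply: gramC Hs.
have As U V : gram A U V = gram A V U by apply: gramC A_sym.
rewrite !(gram_combl, gram_combr).
orient gs X1 X2 X3 X4 X Y.
orient hs X1 X2 X3 X4 X Y.
orient As X1 X2 X3 X4 X Y.
have [n1 n2 n3] := natr_sub_neq0.
have -> : s / (2 * (nR - 2)) = s * (nR - 2)^-1 / 2 by field.
have -> : r / (2 * (nR - 2)) = r * (nR - 2)^-1 / 2 by field.
move: (gram G) (gram H) (gram A) (nR - 2)^-1 (b / _) => g h a v w.
by field.
Qed.

(** Both arguments are eps times those of [Q (eps * sigma)]: the shifts remove the terms in c, and
    eps squared is 1. *)
Lemma tachibana_ricci_riemann sigma X1 X2 X3 X4 X Y :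
  tachibana (ric - ((nR - 1) * c - sigma) *: gram G)
    (riem - (c - sigma / (nR - 2)) *:
       (2^-1 *: kulkarni_nomizu (gram G) (gram G))) X1 X2 X3 X4 X Y =
  Q (eps * sigma) X1 X2 X3 X4 X Y.
Proof.
rewrite /Q /ric gram_mxD (gram_mxD A) !gram_mxZ /tachibana /derivation4 !form4E.
rewrite /kulkarni_nomizu !form2E !riemE.
rewrite !(gram_combl, gram_combr).
have [n1 n2 n3] := natr_sub_neq0.
move: (gram G) (gram H) (gram A) => g h a.
have [->|->] := eps_cases; by field.
Qed.

(** The metric contraction of the first and last slots, which sends the Riemann tensor to the Ricci
    tensor. *)
Definition ricci_contraction (T : form4 R n) X Y := trace (fun Z => sharp G (T Z X Y)).

Lemma contraction_comb x y T T' X Y :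
  ricci_contraction (x *: T + y *: T') X Y =
  x * ricci_contraction T X Y + y * ricci_contraction T' X Y.
Proof.
rewrite /ricci_contraction /trace !mulr_sumr -big_split /=; apply: eq_bigr => i _.
have -> : sharp G ((x *: T + y *: T') (delta_mx 0 i) X Y) =
    x *: sharp G (T (delta_mx 0 i) X Y) + y *: sharp G (T' (delta_mx 0 i) X Y).
  rewrite /sharp !scalemxAl -mulmxDl; congr (_ *m _).
  by apply/rowP => j; rewrite !mxE.
by rewrite !mxE.
Qed.

Lemma trace_comb x y (f g : 'rV[R]_n -> 'rV[R]_n) :
  trace (fun Z => x *: f Z + y *: g Z) = x * trace f + y * trace g.
Proof.
rewrite /trace !mulr_sumr -big_split; apply: eq_bigr => i _.
by rewrite !mxE.
Qed.

Lemma trace_gram (P : 'M[R]_n) V Y : trace (fun Z => gram P Z Y *: V) = gram P V Y.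
Proof.
rewrite [in RHS](row_sum_delta V) /trace; elim/big_rec2 : _ => [|i x y _ ->].
  by rewrite /gram !mul0mx mxE.
by rewrite gramDl gramZl mxE mulrC.
Qed.

Lemma contraction_KN (P : 'M[R]_n) X Y :
  ricci_contraction (kulkarni_nomizu (gram P) (gram P)) X Y =
  2 * (\tr (P *m invmx G) * gram P X Y - gram (P *m invmx G *m P) X Y).
Proof.
rewrite /ricci_contraction; pose h := P *m invmx G.
(* The operator of P /\ P is a multiple of that of P plus a rank-one operator in Z, whose trace is
   given by [trace_gram]. *)
transitivity (trace (fun Z => 2 *: (gram P X Y *: (Z *m h)) + (-2) *: (gram P Z Y *: (X *m h)))).
  congr trace; apply/funext => Z; apply: sharp_unique => // W.
  rewrite /h gramDl !gramZl !gram_endo -mulmxA mulVmx // mulmx1 /kulkarni_nomizu; ring.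
rewrite trace_comb (trace_gram P (X *m h)) gram_endo.
have -> : trace (fun Z => gram P X Y *: (Z *m h)) = gram P X Y * trace (fun Z => Z *m h).
  by rewrite /trace mulr_sumr; apply: eq_bigr => i _; rewrite mxE.
rewrite trace_mul; ring.
Qed.

Context (H2_free : ~ exists x y, H2 = x *: G + y *: H).

(** Since H2 = t H - A, a relation with x nonzero would put H2 in the span of G and H. If x = 0 and
    y is nonzero, then G = 0, hence H = 0 and H2 = 0, again in that span. *)
Lemma A_G_free x y : (forall X Y, x * gram A X Y + y * gram G X Y = 0) -> x = 0 /\ y = 0.
Proof.
move=> xy0; have AG : x *: A + y *: G = 0.
  apply: gram_inj; apply: form2P => X Y.
  rewrite gram_mxD (gram_mxZ x A) (gram_mxZ y G) form2D !form2Z xy0.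
  by rewrite /gram mulmx0 mul0mx mxE.
have x0 : x = 0.
  apply/eqP/negPn/negP => xn; apply: H2_free; exists (x^-1 * y), t.
  have AE : A = - ((x^-1 * y) *: G).
    apply: (scalerI xn); rewrite scalerN scalerA mulrA (mulfV xn) mul1r.
    by apply/eqP; rewrite -addr_eq0 AG.
  have -> : H2 = t *: H - A by rewrite /A opprB addrC subrK.
  by rewrite AE opprK addrC.
split=> //; apply/eqP/negPn/negP => yn; apply: H2_free; exists 0, 0.
have G0 : G = 0.
  by apply: (scalerI yn); rewrite scaler0 -AG x0 scale0r add0r.
have H0 : H = 0 by rewrite -[H]mulmx1 -(mulmxV Gu) G0 mul0mx mulmx0.
by rewrite /H2 {1}H0 !mul0mx !scale0r addr0.
Qed.

Let E : form4 R n :=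
  kulkarni_nomizu (gram G) (fmul G ric ric)
  + ((nR - 2) / 2) *: kulkarni_nomizu ric ric
  - kap *: kulkarni_nomizu (gram G) ric
  + ((kap ^+ 2 - trace_g G (fmul G ric ric)) / (2 * (nR - 1))) *:
      kulkarni_nomizu (gram G) (gram G).

Lemma ricci2E : fmul G ric ric =
  gram ((((nR - 1) * c) ^+ 2) *: G + (2 * ((nR - 1) * c) * eps - psi) *: A).
Proof.
rewrite /ric fmul_gram //; congr gram.
have GG : G *m invmx G *m G = G by rewrite mulmxV // mul1mx.
have GA : G *m invmx G *m A = A by rewrite mulmxV // mul1mx.
have AG : A *m invmx G *m G = A by rewrite -mulmxA mulVmx // mulmx1.
rewrite (mulmxDl (_ *: G)) (mulmxDl (_ *m _)) !(mulmxDr _ (_ *: G)).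
rewrite -!scalemxAl -!scalemxAr GG GA AG mulAA.
move: A => a; apply/matrixP => i j; rewrite !mxE.
have [->|->] := eps_cases; ring.
Qed.

Lemma trace_ricci2 : trace_g G (fmul G ric ric) =
  nR * ((nR - 1) * c) ^+ 2 + (2 * ((nR - 1) * c) * eps - psi) * b.
Proof.
rewrite ricci2E trace_g_gram // (mulmxDl (_ *: G)) -!scalemxAl mulmxV //.
by rewrite linearD !linearZ /= mxtrace1 -/b mulrC.
Qed.

(** E is insensitive to adding a multiple of g to the Ricci tensor, so c disappears and only A
    remains. *)
Lemma EtensorE X1 X2 X3 X4 :
  let g := gram G in let a := gram A in
  E X1 X2 X3 X4 = (nR - 2) * (a X1 X4 * a X2 X3 - a X1 X3 * a X2 X4)
   - (psi + b) * (g X1 X4 * a X2 X3 + g X2 X3 * a X1 X4 - g X1 X3 * a X2 X4 - g X2 X4 * a X1 X3)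
   + b * (b + psi) / (nR - 1) * (g X1 X4 * g X2 X3 - g X1 X3 * g X2 X4).
Proof.
rewrite /= /E trace_ricci2 ricci2E /ric !(gram_mxD (_ *: G)) !(gram_mxZ _ G) !(gram_mxZ _ A).
rewrite !form4E /kulkarni_nomizu !form2E /kap.
have [n1 n2 n3] := natr_sub_neq0.
move: (gram G) (gram A) => g a.
by have [->|->] := eps_cases; field.
Qed.

(* weyl0 and E are the Weyl parts of (1/2) H /\ H and (n-2)/2 A /\ A, and the
   hypothesis makes (1/2) H /\ H proportional, up to g /\ g, to
   B /\ B = A /\ A + 2s g /\ A + s^2 g /\ g. The factor m is the coefficient of A in the
   Ricci contraction of (1/2) B /\ B. *)
Lemma weyl_proportional s :
  (forall X1 X2 X3 X4 X Y, Q s X1 X2 X3 X4 X Y = 0) ->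
  exists lam, lam *: C = E.
Proof.
rewrite /Q; set B := A + s *: G; set T := _ + _ => QT.
have [n1 n2 n3] := natr_sub_neq0.
have Bs : B^T = B by rewrite /B (linearD _ A) linearZ /= A_sym Gs.
have Tc : curvature_like T.
  by apply: curvature_like_comb; apply: curvature_like_KN.
pose m := b + (nR - 2) * s + psi.
have trB : \tr (B *m invmx G) = b + nR * s.
  rewrite /B (mulmxDl A) linearD -scalemxAl mulmxV // linearZ /= mxtrace1.
  by rewrite -/b -/nR [nR * s]mulrC.
have B2 : B *m invmx G *m B = (2 * s - psi) *: A + s ^+ 2 *: G.
  have GG : G *m invmx G *m G = G by rewrite mulmxV // mul1mx.
  have GA : G *m invmx G *m A = A by rewrite mulmxV // mul1mx.
  have AG : A *m invmx G *m G = A by rewrite -mulmxA mulVmx // mulmx1.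
  rewrite /B (mulmxDl A) (mulmxDl (A *m _)) !(mulmxDr _ A).
  rewrite -!scalemxAl -!scalemxAr GG GA AG mulAA.
  by move: A => a; apply/matrixP => i j; rewrite !mxE; ring.
have BX X Y : gram B X Y = gram A X Y + s * gram G X Y.
  by rewrite /B (gram_mxD A) (gram_mxZ s G).
have cB X Y : ricci_contraction (kulkarni_nomizu (gram B) (gram B)) X Y =
    2 * (m * gram A X Y + s * (b + (nR - 1) * s) * gram G X Y).
  rewrite contraction_KN trB B2 (gram_mxD (_ *: A)) (gram_mxZ _ A) (gram_mxZ _ G).
  rewrite !form2E BX /m; ring.
clear B2.
have cT X Y : ricci_contraction T X Y = gram A X Y + s * (nR - 1) / (nR - 2) * gram G X Y.
  rewrite /T contraction_comb !contraction_KN mulmxV // mxtrace1 mul1mx -/t -/H2.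
  rewrite -/nR [in RHS]/A (gram_mxD (t *: H)) gram_mxZ gram_mxN !form2E; field.
  by rewrite n2.
(* If B /\ B = 0, its contraction gives m = 0 and s (b + (n-1) s) = 0. Eliminating a /\ a, psi and b
   by these relations shows E = 0, so the factor 0 works. *)
have [B0|Bn] := pselect (kulkarni_nomizu (gram B) (gram B) = 0).
  exists 0; rewrite scale0r; apply: form4P => X1 X2 X3 X4.
  have [m0 s0] : m = 0 /\ s * (b + (nR - 1) * s) = 0.
    apply: A_G_free => X Y; have := cB X Y; rewrite B0.
    have -> : ricci_contraction 0 X Y = 0.
      by have := contraction_comb 0 0 0 0 X Y; rewrite !scale0r !mul0r !addr0.
    by move=> h; lra.
  have := congr1 (fun K : form4 R n => K X1 X2 X3 X4) B0.
  rewrite EtensorE /kulkarni_nomizu !BX -[RHS]/(0 : R) => bb.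
  move: (gram G X1 X4) (gram G X2 X3) (gram G X1 X3) (gram G X2 X4) bb => g1 g2 g3 g4.
  move: (gram A X1 X4) (gram A X2 X3) (gram A X1 X3) (gram A X2 X4) => a1 a2 a3 a4 bb.
  have -> : a1 * a2 - a3 * a4 =
      - s * (g1 * a2 + g2 * a1 - g3 * a4 - g4 * a3) - s ^+ 2 * (g1 * g2 - g3 * g4).
    by lra.
  have -> : psi + b = - (nR - 2) * s by move: m0; rewrite /m => h; lra.
  have -> : b * (b + psi) / (nR - 1) = (nR - 2) * s ^+ 2.
    have -> : b + psi = - (nR - 2) * s by move: m0; rewrite /m => h; lra.
    have -> : b * (- (nR - 2) * s) / (nR - 1) =
       (nR - 2) * s ^+ 2 - (nR - 2) / (nR - 1) * (s * (b + (nR - 1) * s)) by field.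
    by rewrite s0 mulr0 subr0.
  by transitivity (0 : R); [|ring].
have [l Tl] := tachibana_eq0 Bs Tc QT Bn.
(* Contracting T = l B /\ B and comparing the coefficients of A and g; in particular 2 l m = 1. *)
have [m1 m2] : 1 - 2 * l * m = 0 /\
    s * (nR - 1) / (nR - 2) - 2 * l * (s * (b + (nR - 1) * s)) = 0.
  apply: A_G_free => X Y; have := cT X Y.
  have -> : T = l *: kulkarni_nomizu (gram B) (gram B) + 0 *: T by rewrite scale0r addr0.
  by rewrite contraction_comb cB mul0r addr0 => h; lra.
(* Taking Weyl parts in T = l B /\ B gives (n-2) eps C = 2 l E; multiplying by m and using 2 l m = 1
   gives this factor. *)
exists (eps * (nR - 2) * m); apply: form4P => X1 X2 X3 X4.
have := congr1 (fun K : form4 R n => K X1 X2 X3 X4) Tl.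
rewrite weylE EtensorE /T !form4E /kulkarni_nomizu !BX /weyl0.
move: (gram G X1 X4) (gram G X2 X3) (gram G X1 X3) (gram G X2 X4) => g1 g2 g3 g4.
move: (gram A X1 X4) (gram A X2 X3) (gram A X1 X3) (gram A X2 X4) => a1 a2 a3 a4.
move: (gram H X1 X4) (gram H X2 X3) (gram H X1 X3) (gram H X2 X4) => h1 h2 h3 h4 hh.
have {hh} -> : h1 * h2 - h3 * h4 = 2 * l *
   ((a1 * a2 - a3 * a4) + s * (g1 * a2 + g2 * a1 - g3 * a4 - g4 * a3)
    + s ^+ 2 * (g1 * g2 - g3 * g4))
   - s / (nR - 2) * (g1 * g2 - g3 * g4).
  have e : s / (2 * (nR - 2)) = s / (nR - 2) / 2 by field.
  by move: hh; rewrite e; move: (s / (nR - 2)) => w hh; lra.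
apply/eqP; rewrite -subr_eq0; apply/eqP.
pose gg := g1 * g2 - g3 * g4.
pose bb := a1 * a2 - a3 * a4 + s * (g1 * a2 + g2 * a1 - g3 * a4 - g4 * a3) + s ^+ 2 * gg.
pose S := s * (b + (nR - 1) * s).
(* The difference of the two sides is an explicit combination of the two vanishing expressions of
   [m1] and [m2]. *)
transitivity ((1 - 2 * l * m) * (- (nR - 2) * bb + gg * (nR - 2) * S / (nR - 1))
  - (s * (nR - 1) / (nR - 2) - 2 * l * S) * (m * (nR - 2) * gg / (nR - 1))).
  rewrite /bb /S /gg /m; have [->|->] := eps_cases; field; by rewrite n1 n2.
by rewrite m1 m2 !mul0r subr0.
Qed.
End Pointwise.

(** * Directional derivatives and smooth maps *)

Section DirectionalDerivatives.
Context {R : realType}.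

Lemma derive_entry (V : normedModType R) m n (f : V -> 'M[R]_(m, n)) x v i j :
  derivable f x v -> 'D_v (fun y => f y i j) x = ('D_v f x) i j.
Proof. by move=> fd; rewrite (derive_mx fd) mxE. Qed.

Lemma is_derive_mulmx (V : normedModType R) m n p (f : V -> 'M[R]_(m, n))
    (g : V -> 'M[R]_(n, p)) x v df dg :
  is_derive x v f df -> is_derive x v g dg ->
  is_derive x v (fun y => f y *m g y) (df *m g x + f x *m dg).
Proof.
move=> [fd fE] [gd gE].
have E i j : is_derive x v (fun y => (f y *m g y) i j)
    ((df *m g x + f x *m dg) i j).
  have -> : (fun y => (f y *m g y) i j) =
      \sum_(k < n) ((fun y => f y i k) * (fun y => g y k j)).
    by apply/funext => y; rewrite mxE fct_sumE.
  rewrite !mxE -big_split /=; apply: is_derive_sum => k.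
  have /derivableP f' := (derivable_mxP _ _ _).1 fd i k.
  have /derivableP g' := (derivable_mxP _ _ _).1 gd k j.
  apply: is_derive_eq; rewrite !derive_entry // fE gE.
  by rewrite /GRing.scale /=; ring.
have d : derivable (fun y => f y *m g y) x v.
  by apply/derivable_mxP => i j; case: (E i j).
by split=> //; rewrite derive_mx //; apply/matrixP => i j; rewrite mxE; case: (E i j).
Qed.

Lemma derive_comp (V1 V2 W : normedModType R) (f : V1 -> V2) (g : V2 -> W) x v :
  differentiable f x -> differentiable g (f x) ->
  'D_v (g \o f) x = 'D_('D_v f x) g (f x).
Proof.
move=> fd gd; rewrite !deriveE //; last exact: differentiable_comp.
by rewrite diff_comp.
Qed.

Lemma derive_linear (V W : normedModType R) (f : V -> W) x a v w :
  differentiable f x -> 'D_(a *: v + w) f x = a *: 'D_v f x + 'D_w f x.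
Proof. by move=> fd; rewrite !deriveE // linearP. Qed.

(** Differentiability depends on the germ only: g has the same first-order expansion at x as f. *)
Lemma near_eq_differentiable (V W : normedModType R) (f g : V -> W) x :
  (\near x, f x = g x) -> differentiable f x -> differentiable g x.
Proof.
move=> fg fd.
have E : g \o shift x = cst (g x) + 'd f x +o_ (0 : V) id.
  apply/eqaddoP => e e0; have /eqaddoP/(_ e e0) := diff_locally fd.
  apply: filter_app.
  have : \forall y \near 0, f (y + x) = g (y + x).
    by move: fg; rewrite (near_shift 0) subr0.
  apply: filterS => h /= fgh; rewrite !fctE /= fgh.
  by rewrite (nbhs_singleton fg).
apply/diff_locallyP; rewrite (diff_unique (diff_continuous fd) E).
by split=> //; exact: diff_continuous.
Qed.

(* Two applications of the mean value theorem to the second difference of f. *)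
Lemma second_difference (V : normedModType R) (f : V -> R) (U : set V) u X Y h :
  0 < h ->
  (forall s r, 0 <= s <= h -> 0 <= r <= h -> U (u + s *: X + r *: Y)) ->
  (forall y, U y -> differentiable f y) ->
  (forall y, U y -> differentiable ('D_X f) y) ->
  exists s r, [/\ 0 <= s <= h, 0 <= r <= h &
    f (u + h *: X + h *: Y) - f (u + h *: X) - (f (u + h *: Y) - f u)
    = h ^+ 2 * 'D_Y ('D_X f) (u + s *: X + r *: Y)].
Proof.
move=> h0 UX fd fXd.
have line (k : V -> R) (w Z : V) (t : R) : differentiable k (w + t *: Z) ->
    is_derive t 1 (fun t => k (w + t *: Z)) ('D_Z k (w + t *: Z)).
  move=> kd; pose l : R -> V := cst w + *:%R^~ Z.
  have ld : is_diff t l (0 + *:%R^~ Z) by exact: is_diffD.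
  have lD : 'D_1 l t = Z.
    by rewrite deriveE // diff_val /= add0r scale1r.
  split; first exact/derivable1_diffP/(@differentiable_comp _ _ _ _ l k).
  by rewrite (@derive_comp _ _ _ l k) // lD.
(* The increment of phi over [0, h] is the second difference, and its derivative is an increment of
   'D_X f in the direction Y. *)
pose phi t := f (u + h *: Y + t *: X) - f (u + t *: X).
have hh : 0 <= h <= h by rewrite lexx ltW.
have h00 : 0 <= (0 : R) <= h by rewrite lexx ltW.
have U1 t : 0 <= t <= h -> U (u + h *: Y + t *: X).
  by move=> th; rewrite addrAC; apply: UX.
have U0 t : 0 <= t <= h -> U (u + t *: X).
  by move=> th; have := UX t 0 th h00; rewrite scale0r addr0.
have phid t : 0 <= t <= h -> is_derive t 1 phi ('D_X f (u + h *: Y + t *: X) - 'D_X f (u + t *: X)).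
  by move=> th; apply: is_deriveB; apply: line; apply: fd; [apply: U1|apply: U0].
have io (t : R) : t \in `]0, h[%R -> 0 <= t <= h.
  by rewrite in_itv /= => /andP[t0 th]; rewrite !ltW.
have cc (k dk : R -> R) : (forall t, 0 <= t <= h -> is_derive t 1 k (dk t)) ->
    {within `[0, h], continuous k}.
  move=> kd; apply: derivable_within_continuous => t; rewrite in_itv /= => th.
  by case: (kd t th).
have [s sI sE] := MVT h0 (fun t th => phid t (io t th)) (cc _ _ phid).
have sh := io s sI.
pose psi t := 'D_X f (u + s *: X + t *: Y).
have psid t : 0 <= t <= h -> is_derive t 1 psi ('D_Y ('D_X f) (u + s *: X + t *: Y)).
  by move=> th; apply: line; apply: fXd; apply: UX.
have [r rI rE] := MVT h0 (fun t th => psid t (io t th)) (cc _ _ psid).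
exists s, r; split=> //; first exact: io.
move: sE; rewrite /phi !scale0r !addr0 subr0 => sE.
rewrite [u + h *: X + _]addrAC sE [u + h *: Y + s *: X]addrAC.
move: rE; rewrite /psi scale0r addr0 subr0 => ->.
by rewrite expr2 -mulrA mulrC.
Qed.

(** Schwarz's theorem. In either order of X and Y, the second difference over a small parallelogram
    is h^2 times a value of a mixed derivative; by continuity these values approach those at u. *)
Lemma derive_sym_scalar (V : normedModType R) (f : V -> R) (U : set V) u X Y :
  open U -> U u -> (forall y, U y -> differentiable f y) ->
  (forall y, U y -> differentiable ('D_X f) y) ->
  (forall y, U y -> differentiable ('D_Y f) y) ->
  {for u, continuous ('D_Y ('D_X f))} -> {for u, continuous ('D_X ('D_Y f))} ->
  'D_X ('D_Y f) u = 'D_Y ('D_X f) u.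
Proof.
move=> oU Uu fd fXd fYd cYX cXY; apply/eqP/negPn/negP => neq.
pose d := `|'D_X ('D_Y f) u - 'D_Y ('D_X f) u|.
have d0 : 0 < d / 2 by rewrite divr_gt0 // normr_gt0 subr_eq0.
have /cvgrPdist_lt /(_ _ d0) nY := cYX.
have /cvgrPdist_lt /(_ _ d0) nX := cXY.
have nU := filterS3 _ (fun y a b c => And3 a b c) (open_nbhs_nbhs (conj oU Uu)) nY nX.
have [e /= e0 eU] := (nbhs_normP _ _).1 (nU _).
(* The parallelogram of side parameter h stays within e/2 of u; the added 1 keeps the denominator
   positive when X = Y = 0. *)
pose h := e / (2 * (`|X| + `|Y| + 1)).
have c0 : 0 < `|X| + `|Y| + 1 by rewrite ltr_wpDl // addr_ge0.
have h0 : 0 < h by rewrite divr_gt0 // mulr_gt0.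
have small s r Z W : 0 <= s <= h -> 0 <= r <= h -> `|Z| + `|W| = `|X| + `|Y| ->
    `|u - (u + s *: Z + r *: W)| < e.
  move=> /andP[s0 sh] /andP[r0 rh] ZW.
  rewrite -addrA opprD addrA subrr sub0r normrN.
  apply: le_lt_trans (ler_normD _ _) _; rewrite !normrZ !ger0_norm //.
  apply: (@le_lt_trans _ _ (h * (`|X| + `|Y|))).
    by rewrite -ZW mulrDr lerD // ler_wpM2r.
  apply: (@le_lt_trans _ _ (h * (`|X| + `|Y| + 1))).
    by rewrite ler_wpM2l ?ltW // ltrDl.
  have -> : h * (`|X| + `|Y| + 1) = e / 2 by rewrite /h; field; rewrite gt_eqF.
  by rewrite ltr_pdivrMr // mulr_natr mulr2n ltrDl.
have in1 s r : 0 <= s <= h -> 0 <= r <= h -> [/\ U (u + s *: X + r *: Y),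
    `|'D_Y ('D_X f) u - 'D_Y ('D_X f) (u + s *: X + r *: Y)| < d / 2 &
    `|'D_X ('D_Y f) u - 'D_X ('D_Y f) (u + s *: X + r *: Y)| < d / 2].
  by move=> sh rh; apply: eU; exact: small.
have sd :=
  second_difference h0 (fun a b ha hb => let: And3 H _ _ := in1 a b ha hb in H) fd fXd.
have [s0 [r0 [sh rh E1]]] := sd.
have in2 s r : 0 <= s <= h -> 0 <= r <= h -> U (u + s *: Y + r *: X).
  by move=> sh' rh'; rewrite addrAC; case: (in1 r s rh' sh').
have [s' [r' [sh' rh' E2]]] := second_difference h0 in2 fd fYd.
have [_ B1 _] := in1 s0 r0 sh rh; have [_ _ B2] := in1 r' s' rh' sh'.
rewrite addrAC in B2.
have E : 'D_Y ('D_X f) (u + s0 *: X + r0 *: Y) = 'D_X ('D_Y f) (u + s' *: Y + r' *: X).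
  have hn : h ^+ 2 != 0 by rewrite expf_neq0 // gt_eqF.
  apply: (mulfI hn); rewrite -[LHS]E1 -[RHS]E2 [u + h *: X + _]addrAC.
  by move: (f _) (f _) (f _) (f _) => a b k l; ring.
move: B1 B2; rewrite E.
move: ('D_X ('D_Y f) (u + _ + _)) => z B1 B2.
have : d < d / 2 + d / 2.
  apply: le_lt_trans (ltrD B2 B1); rewrite [X in _ <= _ + X]distrC.
  exact: ler_distD.
by rewrite -splitr ltxx.
Qed.

End DirectionalDerivatives.

(** * Smooth maps on open sets of coordinate spaces *)

Section Smooth.
Context {R : realType} {n : nat}.
Implicit Types (U : set 'rV[R]_n) (W : normedModType R).

Lemma Ck_eq W k U (f g : 'rV[R]_n -> W) : open U -> (forall u, U u -> f u = g u) ->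
  Ck k U f -> Ck k U g.
Proof.
move=> oU; have nU u h : U u -> (forall u, U u -> h u) -> \near u, h u.
  by move=> Uu Uh; apply: filterS (open_nbhs_nbhs (conj oU Uu)).
elim: k f g => [|k IH] f g fg /=.
  move=> fc u Uu; have := fc u Uu; rewrite /prop_for /continuous_at (fg _ Uu); apply: cvg_trans.
  by apply: (near_eq_cvg (F := nbhs u)); apply: nU.
move=> [fd fC]; split=> [u Uu|i]; first exact: near_eq_differentiable (nU _ _ Uu fg) (fd u Uu).
apply: IH (fC i) => u Uu; apply: near_eq_derive; exact: nU fg.
Qed.

Lemma Ck_comb W k U (f g : 'rV[R]_n -> W) a : open U -> Ck k U f -> Ck k U g ->
  Ck k U (fun u => a *: f u + g u).
Proof.
move=> oU; elim: k f g => [|k IH] f g /=.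
  move=> fc gc u Uu; rewrite /prop_for /continuous_at.
  exact: (cvgD (cvgZl_tmp (fc u Uu)) (gc u Uu)).
move=> [fd fC] [gd gC]; split=> [u Uu|i].
  by apply: differentiableD; [apply: differentiableZ; exact: fd|exact: gd].
apply: Ck_eq (IH _ _ (fC i) (gC i)) => // u Uu.
have fu := @diff_derivable _ _ _ _ _ (delta_mx 0 i) (fd u Uu).
have gu := @diff_derivable _ _ _ _ _ (delta_mx 0 i) (gd u Uu).
by rewrite (@deriveD _ _ _ (a \*: f) g) ?deriveZ //; exact: derivableZ.
Qed.

Lemma Ck_cst W k U (a : W) : Ck k U (fun=> a).
Proof.
elim: k a => [|k IH] a /=; first by move=> u _; exact: cst_continuous.
split=> [u _|i]; first exact: differentiable_cst.
have -> : (fun u : 'rV[R]_n => 'D_(delta_mx 0 i) (fun=> a) u) = (fun=> (0 : W)).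
  by apply/funext => u; exact: derive_cst.
exact: IH.
Qed.

Lemma smooth_differentiable W U (f : 'rV[R]_n -> W) u :
  smooth U f -> U u -> differentiable f u.
Proof. by move=> fs; case: (fs 1) => fd _; exact: fd. Qed.

Lemma smooth_continuous W U (f : 'rV[R]_n -> W) u :
  smooth U f -> U u -> {for u, continuous f}.
Proof. by move=> fs; apply: (fs 0). Qed.

Lemma derive_coord W (f : 'rV[R]_n -> W) u X : differentiable f u ->
  'D_X f u = \sum_i X 0 i *: 'D_(delta_mx 0 i) f u.
Proof.
move=> fd; rewrite deriveE // [in LHS](row_sum_delta X) linear_sum.
by apply: eq_bigr => i _; rewrite linearZ deriveE.
Qed.

(** [Ck] speaks of coordinate directions only; a general directional derivative is a constant
    combination of these. *)
Lemma smooth_derive W U (f : 'rV[R]_n -> W) X : open U -> smooth U f ->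
  smooth U ('D_X f).
Proof.
move=> oU fs k.
apply: (@Ck_eq _ _ _ (fun u => \sum_i X 0 i *: 'D_(delta_mx 0 i) f u)) => //.
  by move=> u Uu; rewrite -derive_coord //; exact: smooth_differentiable Uu.
elim: (index_enum _) => [|i s IH].
  by under eq_fun do rewrite big_nil; exact: Ck_cst.
under eq_fun do rewrite big_cons; apply: Ck_comb => //.
by case: (fs k.+1) => _; apply.
Qed.

Lemma smooth_entry m p U (f : 'rV[R]_n -> 'M[R]_(m, p)) i j : open U ->
  smooth U f -> smooth U (fun u => f u i j : R).
Proof.
move=> oU fs k; elim: k f fs => [|k IH] f fs /=.
  move=> u Uu; apply: (@continuous_comp _ _ _ f (fun M : 'M[R]_(m, p) => M i j)).
    exact: smooth_continuous Uu.
  exact: coord_continuous.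
have ed u : U u -> differentiable (fun u => f u i j : R) u.
  move=> Uu; apply: (@differentiable_comp _ _ _ _ f (fun M : 'M[R]_(m, p) => M i j : R)).
    exact: smooth_differentiable Uu.
  exact: differentiable_coord.
split=> // l; apply: Ck_eq (IH _ (smooth_derive (delta_mx 0 l) oU fs)) => // u Uu.
rewrite derive_entry //; apply: diff_derivable; exact: smooth_differentiable Uu.
Qed.

Lemma smooth_derive_sym m p U (f : 'rV[R]_n -> 'M[R]_(m, p)) u X Y : open U ->
  smooth U f -> U u -> 'D_X ('D_Y f) u = 'D_Y ('D_X f) u.
Proof.
move=> oU fs Uu; apply/matrixP => i j.
have fd Z v : U v -> derivable f v Z.
  by move=> Uv; apply/diff_derivable/(smooth_differentiable fs).
have fdd Z Z' v : U v -> derivable ('D_Z f) v Z'.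
  by move=> Uv; apply/diff_derivable/(smooth_differentiable (smooth_derive Z oU fs)).
pose e u : R := f u i j.
have es : smooth U e by exact: smooth_entry.
have eD Z Z' : ('D_Z ('D_Z' f) u) i j = 'D_Z ('D_Z' e) u.
  rewrite -derive_entry; last exact: fdd.
  apply: near_eq_derive; apply: filterS (open_nbhs_nbhs (conj oU Uu)) => v Uv.
  by rewrite /e derive_entry //; exact: fd.
move: eD es; move: e => e eD es.
etransitivity; first exact: eD.
etransitivity; last exact/esym/eD.
apply: (derive_sym_scalar oU Uu) => [v Uv|v Uv|v Uv||].
- exact: smooth_differentiable es Uv.
- exact: smooth_differentiable (smooth_derive X oU es) Uv.
- exact: smooth_differentiable (smooth_derive Y oU es) Uv.
- exact: smooth_continuous (smooth_derive Y oU (smooth_derive X oU es)) Uu.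
- exact: smooth_continuous (smooth_derive X oU (smooth_derive Y oU es)) Uu.
Qed.

End Smooth.

(** * Derivatives of matrix-valued maps *)

Section MatrixDerivatives.
Context {R : realType}.
Implicit Types (V : normedModType R).

Lemma gram_sharp n (G : 'M[R]_n) (f : 'rV[R]_n -> R) Z : G \in unitmx ->
  (forall a X Y, f (a *: X + Y) = a * f X + f Y) -> gram G (sharp G f) Z = f Z.
Proof.
move=> Gu fl; rewrite (linear_form_sum Z fl) /gram /sharp mulmxKV // mxE.
by apply: eq_bigr => i _; rewrite !mxE mulrC.
Qed.

Lemma is_derive_row V m (f : 'I_m -> V -> R) x v df :
  (forall i, is_derive x v (f i) (df i)) ->
  is_derive x v (fun y => \row_i f i y) (\row_i df i).
Proof.
move=> fd; have E i j : (fun y => (\row_i f i y) i j) = f j.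
  by apply/funext => y; rewrite mxE.
have d : derivable (fun y => \row_i f i y) x v.
  by apply/derivable_mxP => i j; rewrite E; case: (fd j).
by split=> //; rewrite derive_mx //; apply/matrixP => i j; rewrite !mxE E; case: (fd j).
Qed.

Lemma is_derive_gram V n (M : V -> 'M[R]_n) (A B : V -> 'rV[R]_n) x v dM dA dB :
  is_derive x v M dM -> is_derive x v A dA -> is_derive x v B dB ->
  is_derive x v (fun y => gram (M y) (A y) (B y))
    (gram dM (A x) (B x) + gram (M x) dA (B x) + gram (M x) (A x) dB).
Proof.
move=> Md Ad Bd.
have Btd : is_derive x v (fun y => (B y)^T) (dB^T).
  case: Bd => Bd <-; have d : derivable (fun y => (B y)^T) x v.
    apply/derivable_mxP => i j; under eq_fun do rewrite mxE.
    exact: (derivable_mxP _ _ _).1 Bd j i.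
  split=> //; apply/matrixP => i j; rewrite -derive_entry // mxE.
  by under eq_fun do rewrite mxE; rewrite derive_entry.
have [d dE] := is_derive_mulmx (is_derive_mulmx Ad Md) Btd.
split; first exact: (derivable_mxP _ _ _).1 d 0 0.
rewrite /gram derive_entry // dE !mulmxDl !mxE -!addrA.
by rewrite addrCA.
Qed.

Lemma differentiable_sum_seq V I (s : seq I) (f : I -> V -> R) x :
  (forall i, differentiable (f i) x) -> differentiable (fun y => \sum_(i <- s) f i y) x.
Proof.
move=> fd; elim: s => [|i s IH].
  by under eq_fun do rewrite big_nil; exact: differentiable_cst.
by under eq_fun do rewrite big_cons; exact: differentiableD.
Qed.

Lemma differentiable_prod_seq V I (s : seq I) (f : I -> V -> R) x :
  (forall i, differentiable (f i) x) -> differentiable (fun y => \prod_(i <- s) f i y) x.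
Proof.
move=> fd; elim: s => [|i s IH].
  by under eq_fun do rewrite big_nil; exact: differentiable_cst.
by under eq_fun do rewrite big_cons; exact: differentiableM.
Qed.

Lemma differentiable_det V n (M : V -> 'M[R]_n) x :
  (forall i j, differentiable (fun y => M y i j : R) x) ->
  differentiable (fun y => \det (M y) : R) x.
Proof.
move=> Md; apply: differentiable_sum_seq => s.
apply: differentiableM; first exact: differentiable_cst.
exact: differentiable_prod_seq.
Qed.

(** Cramer's rule: near x the entries of the inverse are cofactors divided by the determinant. *)
Lemma differentiable_invmx V n (M : V -> 'M[R]_n) x i j :
  (\forall y \near x, M y \in unitmx) ->
  (forall i j, differentiable (fun y => M y i j : R) x) ->
  differentiable (fun y => invmx (M y) i j : R) x.
Proof.
move=> Mu Md.
apply: (@near_eq_differentiable _ _ _ (fun y => (\det (M y))^-1 * cofactor (M y) j i : R)).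
  by apply: filterS Mu => y yu; rewrite /invmx yu !mxE.
have du : \det (M x) != 0.
  by have := nbhs_singleton Mu; rewrite unitmxE unitfE.
apply: differentiableM; first by apply: differentiableV => //; exact: differentiable_det.
apply: differentiableM; first exact: differentiable_cst.
by apply: differentiable_det => k l; under eq_fun do rewrite !mxE; exact: Md.
Qed.

Lemma differentiable_mx V m n (M : V -> 'M[R]_(m, n)) x :
  (forall i j, differentiable (fun y => M y i j : R) x) -> differentiable M x.
Proof.
move=> Md.
have -> : M = \sum_(i < m) \sum_(j < n) (fun y => M y i j *: (delta_mx i j : 'M[R]_(m, n))).
  apply/funext => y; rewrite fct_sumE [LHS]matrix_sum_delta.
  by apply: eq_bigr => i _; rewrite fct_sumE.
apply: differentiable_sum => i; apply: differentiable_sum => j.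
exact: differentiableZl.
Qed.

End MatrixDerivatives.

(** * Christoffel symbols and curvature *)

(* Keeps unification from unfolding derivatives into limits. *)
#[local] Opaque derive.

Section Christoffel.
Context {R : realType} {m : nat}.
Implicit Types (G : 'rV[R]_m -> 'M[R]_m) (y X Y Z : 'rV[R]_m).

(** Fixing the upper index makes each component of [christoffel_form] a [gram], so that bilinearity
    and the product rule carry over. *)
Definition christoffel_mx G y (l : 'I_m) : 'M[R]_m := \matrix_(i, j) christoffel G y i j l.

Lemma christoffel_form_gram G y X Y :
  christoffel_form G y X Y = \row_l gram (christoffel_mx G y l) X Y.
Proof.
apply/rowP => l; rewrite !mxE gram_sum; apply: eq_bigr => i _.
by apply: eq_bigr => j _; rewrite mxE.
Qed.

Lemma christoffel_formDl G y X X' Y :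
  christoffel_form G y (X + X') Y = christoffel_form G y X Y + christoffel_form G y X' Y.
Proof. by rewrite !christoffel_form_gram; apply/rowP => l; rewrite !mxE gramDl. Qed.

Lemma christoffel_formZl G y a X Y :
  christoffel_form G y (a *: X) Y = a *: christoffel_form G y X Y.
Proof. by rewrite !christoffel_form_gram; apply/rowP => l; rewrite !mxE gramZl. Qed.

Lemma christoffel_form0l G y Y : christoffel_form G y 0 Y = 0.
Proof. by rewrite christoffel_form_gram; apply/rowP => l; rewrite !mxE gram0l. Qed.

Lemma christoffel_formDr G y X X' Y :
  christoffel_form G y Y (X + X') = christoffel_form G y Y X + christoffel_form G y Y X'.
Proof. by rewrite !christoffel_form_gram; apply/rowP => l; rewrite !mxE gramDr. Qed.

(* Christoffel symbols of the first kind, see gram_christoffel. *)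
Definition christoffel1 G y X Y Z : R :=
  2^-1 * (gram ('D_X G y) Y Z + gram ('D_Y G y) X Z - gram ('D_Z G y) X Y).

Context (G : 'rV[R]_m -> 'M[R]_m) (y : 'rV[R]_m).
Context (Gd : differentiable G y) (Gs : (G y)^T = G y) (Gu : G y \in unitmx).

Lemma christoffel1_lin1 a X X' Y Z :
  christoffel1 G y (a *: X + X') Y Z = a * christoffel1 G y X Y Z + christoffel1 G y X' Y Z.
Proof.
rewrite /christoffel1 derive_linear // gram_mxD gram_mxZ form2D form2Z.
move: ('D_X G y) ('D_X' G y) ('D_Y G y) ('D_Z G y) => A1 A2 A3 A4.
by rewrite !(gramDl, gramZl); ring.
Qed.

Lemma christoffel1_lin2 a X X' Y Z :
  christoffel1 G y Y (a *: X + X') Z = a * christoffel1 G y Y X Z + christoffel1 G y Y X' Z.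
Proof.
rewrite /christoffel1 derive_linear // gram_mxD gram_mxZ form2D form2Z.
move: ('D_X G y) ('D_X' G y) ('D_Y G y) ('D_Z G y) => A1 A2 A3 A4.
by rewrite !(gramDl, gramZl, gramDr, gramZr); ring.
Qed.

Lemma christoffel1_lin3 a X X' Y Z :
  christoffel1 G y Y Z (a *: X + X') = a * christoffel1 G y Y Z X + christoffel1 G y Y Z X'.
Proof.
rewrite /christoffel1 derive_linear // gram_mxD gram_mxZ form2D form2Z.
move: ('D_X G y) ('D_X' G y) ('D_Y G y) ('D_Z G y) => A1 A2 A3 A4.
by rewrite !(gramDr, gramZr); ring.
Qed.

Lemma christoffel_formE X Y :
  christoffel_form G y X Y = sharp (G y) (christoffel1 G y X Y).
Proof.
apply/rowP => l; rewrite !mxE.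
under [RHS]eq_bigr => k _.
  rewrite mxE (linear_form_sum (f := fun X => christoffel1 G y X Y _)) => [|a ? ?];
    last exact: christoffel1_lin1.
  rewrite mulr_suml; under eq_bigr => i _.
    rewrite (linear_form_sum (f := fun Y => christoffel1 G y _ Y _)) => [|a ? ?];
      last exact: christoffel1_lin2.
    rewrite mulr_sumr mulr_suml; over.
  over.
rewrite [RHS]exchange_big; apply: eq_bigr => i _ /=.
rewrite [RHS]exchange_big; apply: eq_bigr => j _ /=.
rewrite /christoffel mulrA mulr_sumr; apply: eq_bigr => k _.
have invs : invmx (G y) l k = invmx (G y) k l.
  by rewrite -[in RHS]Gs -trmx_inv mxE.
have dE a b d : 'D_(delta_mx 0 a) (fun v => G v b d) y = ('D_(delta_mx 0 a) G y) b d.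
  by rewrite derive_entry //; exact: diff_derivable.
rewrite invs /christoffel1 !dE.
move: ('D_(delta_mx 0 i) G y) ('D_(delta_mx 0 j) G y) ('D_(delta_mx 0 k) G y) => A1 A2 A3.
by rewrite !gram_delta; ring.
Qed.

Lemma gram_christoffel X Y Z :
  gram (G y) (christoffel_form G y X Y) Z = christoffel1 G y X Y Z.
Proof. by rewrite christoffel_formE gram_sharp // => *; exact: christoffel1_lin3. Qed.

Context (Gsn : \forall z \near y, (G z)^T = G z).

(** Symmetry is assumed near y, as the derivative depends on the germ of G. *)
Lemma derive_metric_sym X : ('D_X G y)^T = 'D_X G y.
Proof.
have Gd' := @diff_derivable _ _ _ _ _ X Gd.
apply/matrixP => i j; rewrite mxE -!derive_entry //; apply: near_eq_derive.
by apply: filterS Gsn => z zs; rewrite -[in RHS]zs mxE.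
Qed.

Lemma christoffel_formC X Y : christoffel_form G y X Y = christoffel_form G y Y X.
Proof.
rewrite !christoffel_formE; congr sharp; apply/funext => Z.
rewrite /christoffel1; move: (derive_metric_sym Z).
move: ('D_X G y) ('D_Y G y) ('D_Z G y) => A1 A2 A3 A3s.
by rewrite (gramC X Y A3s) [_ + gram A2 _ _]addrC.
Qed.

(** In the sum of the first-kind symbols of (X, Y, Z) and (X, Z, Y), all but the derivative along X
    cancels. *)
Lemma metric_compatible X Y Z : gram ('D_X G y) Y Z =
  gram (G y) (christoffel_form G y X Y) Z + gram (G y) Y (christoffel_form G y X Z).
Proof.
rewrite (gramC Y (christoffel_form _ _ _ _) Gs) !gram_christoffel /christoffel1.
move: (derive_metric_sym X) (derive_metric_sym Y) (derive_metric_sym Z).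
move: ('D_X G y) ('D_Y G y) ('D_Z G y) => A1 A2 A3 s1 s2 s3.
by rewrite (gramC Z Y s1) (gramC X Z s2) (gramC X Y s3); field.
Qed.

End Christoffel.

Lemma differentiable_christoffel_mx (R : realType) m (V : set 'rV[R]_m)
    (G : 'rV[R]_m -> 'M[R]_m) y l :
  open V -> V y -> smooth V G -> (forall z, V z -> G z \in unitmx) ->
  differentiable (christoffel_mx G ^~ l) y.
Proof.
move=> oV Vy Gsm Gu; apply: differentiable_mx => i j; under eq_fun do rewrite mxE.
have dd a b d : differentiable (fun z => 'D_(delta_mx 0 a) (fun v => G v b d) z : R) y.
  apply: (@smooth_differentiable _ _ _ V) => //; apply: smooth_derive => //.
  exact: smooth_entry.
have di a b : differentiable (fun z => invmx (G z) a b : R) y.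
  apply: differentiable_invmx => [|c d].
    by apply: filterS (open_nbhs_nbhs (conj oV Vy)); exact: Gu.
  exact: smooth_differentiable (smooth_entry c d oV Gsm) Vy.
apply: differentiableM; first exact: differentiable_cst.
apply: differentiable_sum_seq => k; apply: differentiableM => //.
by apply: differentiableB => //; apply: differentiableD.
Qed.

Lemma is_derive_christoffel (R : realType) (W : normedModType R) m
    (G : 'rV[R]_m -> 'M[R]_m) (F A B : W -> 'rV[R]_m) u X dA dB :
  differentiable F u -> (forall l, differentiable (christoffel_mx G ^~ l) (F u)) ->
  is_derive u X A dA -> is_derive u X B dB ->
  is_derive u X (fun v => christoffel_form G (F v) (A v) (B v))
   ('D_('D_X F u) (fun y => christoffel_form G y (A u) (B u)) (F u)
    + christoffel_form G (F u) dA (B u) + christoffel_form G (F u) (A u) dB).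
Proof.
move=> Fd Gd Ad Bd.
have -> : (fun v => christoffel_form G (F v) (A v) (B v)) =
    fun v => \row_l gram (christoffel_mx G (F v) l) (A v) (B v).
  by apply/funext => v; rewrite christoffel_form_gram.
have Md l : is_derive u X (fun v => christoffel_mx G (F v) l)
    ('D_('D_X F u) (christoffel_mx G ^~ l) (F u)).
  split; first exact/diff_derivable/(@differentiable_comp _ _ _ _ F (christoffel_mx G ^~ l)).
  by rewrite (derive_comp (g := christoffel_mx G ^~ l)).
apply: is_derive_eq (is_derive_row (fun l => is_derive_gram (Md l) Ad Bd)) _.
have -> : (fun y => christoffel_form G y (A u) (B u)) =
    fun y => \row_l gram (christoffel_mx G y l) (A u) (B u).
  by apply/funext => y; rewrite christoffel_form_gram.
have [_ ->] := is_derive_row (fun l => is_derive_gram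
   (derivableP (diff_derivable (v := 'D_X F u) (Gd l)))
   (is_derive_cst (A u) (F u) ('D_X F u)) (is_derive_cst (B u) (F u) ('D_X F u))).
rewrite !christoffel_form_gram; apply/rowP => l; rewrite !mxE.
by rewrite gram0l gram0r !addr0.
Qed.

Lemma curvatureE (R : realType) m (G : 'rV[R]_m -> 'M[R]_m) y X Y Z :
  curvature G y X Y Z =
  'D_X (fun v => christoffel_form G v Y Z) y + christoffel_form G y X (christoffel_form G y Y Z)
  - ('D_Y (fun v => christoffel_form G v X Z) y
     + christoffel_form G y Y (christoffel_form G y X Z)).
Proof.
rewrite /curvature /curvature_fields /nabla /lie_bracket /cst.
have E A B : (fun v => 'D_A (fun=> B) v + christoffel_form G v A B) =
    fun v => christoffel_form G v A B.
  by apply/funext => v; rewrite derive_cst add0r.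
by rewrite !E !derive_cst !subrr !add0r christoffel_form0l subr0.
Qed.

#[local] Opaque christoffel_form gram.

(** * Covariant differentiation and curvature along a map *)

Section AlongMap.
Context {R : realType} {n m : nat}.
Context (U : set 'rV[R]_n) (V : set 'rV[R]_m) (F : 'rV[R]_n -> 'rV[R]_m).
Context (G : 'rV[R]_m -> 'M[R]_m).
Context (oU : open U) (oV : open V) (Fsm : smooth U F) (FV : forall u, U u -> V (F u)).
Context (Gsm : smooth V G) (Gs : forall y, V y -> (G y)^T = G y).
Context (Gu : forall y, V y -> G y \in unitmx).
Implicit Types (u X Y Z T : 'rV[R]_n).

Let W X Y := nabla_along G F X ('D_Y F).

Let Fd u : U u -> differentiable F u.
Proof. exact: smooth_differentiable. Qed.

Let Gd u : U u -> differentiable G (F u).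
Proof. by move=> /FV; exact: smooth_differentiable. Qed.

Let Gsn u : U u -> \forall z \near F u, (G z)^T = G z.
Proof. by move=> /FV Vu; apply: filterS (open_nbhs_nbhs (conj oV Vu)). Qed.

Let F1 u X Y : U u -> is_derive u X ('D_Y F) ('D_X ('D_Y F) u).
Proof.
move=> Uu; apply/derivableP/diff_derivable.
exact: smooth_differentiable (smooth_derive Y oU Fsm) Uu.
Qed.

Let F2 u X Y Z : U u -> is_derive u X ('D_Y ('D_Z F)) ('D_X ('D_Y ('D_Z F)) u).
Proof.
move=> Uu; apply/derivableP/diff_derivable.
exact: smooth_differentiable (smooth_derive Y oU (smooth_derive Z oU Fsm)) Uu.
Qed.

Let S2 u X Y : U u -> 'D_X ('D_Y F) u = 'D_Y ('D_X F) u.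
Proof. exact: (@smooth_derive_sym R n 1 m U F u X Y oU Fsm). Qed.

Let S3 u X Y Z : U u -> 'D_X ('D_Y ('D_Z F)) u = 'D_Y ('D_X ('D_Z F)) u.
Proof. exact: (@smooth_derive_sym R n 1 m U ('D_Z F) u X Y oU (smooth_derive Z oU Fsm)). Qed.

Let WE u X Y : W X Y u =
  'D_X ('D_Y F) u + christoffel_form G (F u) ('D_X F u) ('D_Y F u).
Proof. by []. Qed.

(** Mixed second derivatives of F commute and the connection is torsion-free. *)
Lemma nabla_alongC u X Y : U u -> W X Y u = W Y X u.
Proof.
move=> Uu; have GC := christoffel_formC (Gd Uu) (Gs (FV Uu)) (Gsn Uu).
exact: (f_equal2 +%R (S2 X Y Uu) (GC _ _)).
Qed.

Lemma is_derive_metric_along u X (A B : 'rV[R]_n -> 'rV[R]_m) dA dB : U u ->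
  is_derive u X A dA -> is_derive u X B dB ->
  is_derive u X (fun v => gram (G (F v)) (A v) (B v))
    (gram (G (F u)) (dA + christoffel_form G (F u) ('D_X F u) (A u)) (B u)
     + gram (G (F u)) (A u) (dB + christoffel_form G (F u) ('D_X F u) (B u))).
Proof.
move=> Uu Ad Bd.
have Md : is_derive u X (fun v => G (F v)) ('D_('D_X F u) G (F u)).
  split; last by rewrite (derive_comp (g := G)) //; [exact: Fd|exact: Gd].
  by apply/diff_derivable/(@differentiable_comp _ _ _ _ F G); [exact: Fd|exact: Gd].
apply: is_derive_eq (is_derive_gram Md Ad Bd) _.
rewrite (metric_compatible (Gd Uu) (Gs (FV Uu)) (Gu (FV Uu)) (Gsn Uu)) gramDl gramDr.
by move: (gram _ _ _) (gram _ _ _) (gram _ _ _) (gram _ _ _) => a b d e; ring.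
Qed.

Let dW X Y Z u := 'D_X ('D_Y ('D_Z F)) u
  + ('D_('D_X F u) (fun y => christoffel_form G y ('D_Y F u) ('D_Z F u)) (F u)
     + christoffel_form G (F u) ('D_X ('D_Y F) u) ('D_Z F u)
     + christoffel_form G (F u) ('D_Y F u) ('D_X ('D_Z F) u)).

Let W1 u X Y Z : U u -> is_derive u X (W Y Z) (dW X Y Z u).
Proof.
move=> Uu; apply: is_deriveD; first exact: F2.
apply: is_derive_christoffel; [exact: Fd| |exact: F1|exact: F1].
by move=> l; exact: differentiable_christoffel_mx oV (FV Uu) Gsm Gu.
Qed.

(** Curvature is the commutator of covariant derivatives along F. Third derivatives of F and the
    terms containing 'D_X ('D_Y F) cancel by symmetry. *)
Lemma curvature_along u X Y Z : U u ->
  (dW X Y Z u + christoffel_form G (F u) ('D_X F u) (W Y Z u))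
  - (dW Y X Z u + christoffel_form G (F u) ('D_Y F u) (W X Z u))
  = curvature G (F u) ('D_X F u) ('D_Y F u) ('D_Z F u).
Proof.
move=> Uu; rewrite curvatureE /dW !WE.
have := S2 X Y Uu; have := S3 X Y Z Uu.
generalize ('D_X ('D_Y ('D_Z F)) u) ('D_Y ('D_X ('D_Z F)) u) => p p' ->.
generalize ('D_X ('D_Y F) u) ('D_Y ('D_X F) u) => q q' ->.
generalize ('D_Y ('D_Z F) u) ('D_X ('D_Z F) u) => r s.
generalize ('D_('D_X F u) (fun y => christoffel_form G y ('D_Y F u) ('D_Z F u)) (F u)).
generalize ('D_('D_Y F u) (fun y => christoffel_form G y ('D_X F u) ('D_Z F u)) (F u)).
generalize ('D_X F u) ('D_Y F u) ('D_Z F u) => x y z a b.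
rewrite !christoffel_formDr.
repeat match goal with |- context [christoffel_form G ?v ?c ?d] =>
  generalize (christoffel_form G v c d); intro end.
by apply/rowP => i; rewrite !mxE; ring.
Qed.

(** Metric compatibility trades the covariant derivative of W Y Z paired with F_T for the derivative
    of G(W Y Z, F_T) minus G(W Y Z, W X T). *)
Lemma gram_curvature_along u X Y Z T : U u ->
  gram (G (F u)) (curvature G (F u) ('D_X F u) ('D_Y F u) ('D_Z F u)) ('D_T F u) =
  'D_X (fun v => gram (G (F v)) (W Y Z v) ('D_T F v)) u
  - 'D_Y (fun v => gram (G (F v)) (W X Z v) ('D_T F v)) u
  - gram (G (F u)) (W Y Z u) (W X T u) + gram (G (F u)) (W X Z u) (W Y T u).
Proof.
move=> Uu; rewrite -curvature_along //.
have E X' Y' : 'D_X' (fun v => gram (G (F v)) (W Y' Z v) ('D_T F v)) u =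
    gram (G (F u)) (dW X' Y' Z u + christoffel_form G (F u) ('D_X' F u) (W Y' Z u)) ('D_T F u)
    + gram (G (F u)) (W Y' Z u) (W X' T u).
  by case: (is_derive_metric_along Uu (W1 X' Y' Z Uu) (F1 X' T Uu)).
move: (E X Y) (E Y X).
generalize ('D_X (fun v => gram (G (F v)) (W Y Z v) ('D_T F v)) u) => a ->.
generalize ('D_Y (fun v => gram (G (F v)) (W X Z v) ('D_T F v)) u) => b ->.
generalize (dW X Y Z u + christoffel_form G (F u) ('D_X F u) (W Y Z u)).
generalize (dW Y X Z u + christoffel_form G (F u) ('D_Y F u) (W X Z u)).
generalize ('D_T F u) (W Y Z u) (W X T u) (W X Z u) (W Y T u) => t w1 w2 w3 w4 c1 c2.
by rewrite gramDl gramNl; ring.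
Qed.

End AlongMap.

(** * The induced metric and the Gauss equation in coordinates *)

Section InducedMetric.
Context {R : realType} {n m : nat}.
Context (U : set 'rV[R]_n) (V : set 'rV[R]_m) (F : 'rV[R]_n -> 'rV[R]_m).
Context (G : 'rV[R]_m -> 'M[R]_m) (g : 'rV[R]_n -> 'M[R]_n).
Context (oU : open U) (oV : open V) (Fsm : smooth U F) (FV : forall u, U u -> V (F u)).
Context (Gsm : smooth V G) (Gs : forall y, V y -> (G y)^T = G y).
Context (Gu : forall y, V y -> G y \in unitmx).
Context (gsm : smooth U g) (gs : forall u, U u -> (g u)^T = g u).
Context (gu : forall u, U u -> g u \in unitmx).
Context (gE : forall u X Y, U u -> gram (g u) X Y = gram (G (F u)) ('D_X F u) ('D_Y F u)).
Implicit Types (u X Y Z T : 'rV[R]_n).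

Let W X Y := nabla_along G F X ('D_Y F).

Lemma smooth_id : smooth U id.
Proof.
move=> [|k] /=; first by move=> u _; exact: cvg_id.
split=> [u _|i]; first exact: ex_diff.
have -> : (fun u : 'rV[R]_n => 'D_(delta_mx 0 i) id u) = (fun=> delta_mx 0 i).
  by apply/funext => u; rewrite derive_id.
exact: Ck_cst.
Qed.

(** Koszul's argument: differentiating the isometry relation [gE] in three directions and using the
    symmetry of W shows that the tangential part of W X Y is the Levi-Civita derivative of g. *)
Lemma gram_nabla_along u X Y Z : U u ->
  gram (G (F u)) (W X Y u) ('D_Z F u) = gram (g u) (christoffel_form g u X Y) Z.
Proof.
move=> Uu; rewrite gram_christoffel; last 1 first.
all: try by [exact: smooth_differentiable gsm Uu | exact: gs | exact: gu].
have F1 A B : is_derive u A ('D_B F) ('D_A ('D_B F) u).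
  apply/derivableP/diff_derivable.
  exact: smooth_differentiable (smooth_derive B oU Fsm) Uu.
have gD A B C : gram ('D_A g u) B C =
    gram (G (F u)) (W A B u) ('D_C F u) + gram (G (F u)) ('D_B F u) (W A C u).
  have gd : is_derive u A g ('D_A g u).
    by apply/derivableP/diff_derivable; exact: smooth_differentiable gsm Uu.
  have [_] := is_derive_gram gd (is_derive_cst B u A) (is_derive_cst C u A).
  rewrite gram0l gram0r !addr0 => <-.
  have [_ <-] := is_derive_metric_along oV Fsm FV Gsm Gs Gu Uu (F1 A B) (F1 A C).
  apply: near_eq_derive; apply: filterS (open_nbhs_nbhs (conj oU Uu)) => v Uv.
  exact: gE.
have WC A B : W A B u = W B A u by exact: (nabla_alongC oU oV Fsm FV Gsm Gs).
rewrite /christoffel1; move: (gD X Y Z) (gD Y X Z) (gD Z X Y).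
generalize ('D_X g u) ('D_Y g u) ('D_Z g u) => A1 A2 A3 -> -> ->.
have GC A B := gramC A B (Gs (FV Uu)).
rewrite (WC Y X) (WC Z X) (WC Z Y).
generalize (W X Y u) (W X Z u) (W Y Z u) ('D_X F u) ('D_Y F u) ('D_Z F u).
move=> wxy wxz wyz x y z.
by rewrite (GC y wxz) (GC x wyz); field.
Qed.

(* gram_curvature_along for F and for the identity, compared by means of
   gram_nabla_along. *)
Lemma gauss_local u X Y Z T : U u ->
  gram (g u) (curvature g u X Y Z) T =
  gram (G (F u)) (curvature G (F u) ('D_X F u) ('D_Y F u) ('D_Z F u)) ('D_T F u)
  + (gram (G (F u)) (W Y Z u) (W X T u)
      - gram (g u) (christoffel_form g u Y Z) (christoffel_form g u X T))
  - (gram (G (F u)) (W X Z u) (W Y T u)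
      - gram (g u) (christoffel_form g u X Z) (christoffel_form g u Y T)).
Proof.
move=> Uu.
have FE : gram (G (F u)) (curvature G (F u) ('D_X F u) ('D_Y F u) ('D_Z F u)) ('D_T F u) =
  'D_X (fun v => gram (G (F v)) (W Y Z v) ('D_T F v)) u
  - 'D_Y (fun v => gram (G (F v)) (W X Z v) ('D_T F v)) u
  - gram (G (F u)) (W Y Z u) (W X T u) + gram (G (F u)) (W X Z u) (W Y T u).
  exact: (gram_curvature_along oU oV Fsm FV Gsm Gs Gu X Y Z T Uu).
have dI A : 'D_A id = (fun=> A) :> ('rV[R]_n -> 'rV[R]_n).
  by apply/funext => v; rewrite derive_id.
have dIv A v : 'D_A id v = A :> 'rV[R]_n by rewrite derive_id.
have WI A B v : nabla_along g id A ('D_B id) v = christoffel_form g v A B.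
  by rewrite /nabla_along !dI derive_cst add0r !dIv.
(* The two functions agree on the open set U by [gram_nabla_along], so their derivatives at u
   agree. *)
have DE A B : 'D_A (fun v => gram (G (F v)) (W B Z v) ('D_T F v)) u =
    'D_A (fun v => gram (g v) (nabla_along g id B ('D_Z id) v) ('D_T id v)) u.
  apply: near_eq_derive; apply: filterS (open_nbhs_nbhs (conj oU Uu)) => v Uv.
  by rewrite WI dIv gram_nabla_along.
have gE' : gram (g u) (curvature g u X Y Z) T =
  'D_X (fun v => gram (g v) (nabla_along g id Y ('D_Z id) v) ('D_T id v)) u
  - 'D_Y (fun v => gram (g v) (nabla_along g id X ('D_Z id) v) ('D_T id v)) u
  - gram (g u) (christoffel_form g u Y Z) (christoffel_form g u X T)
  + gram (g u) (christoffel_form g u X Z) (christoffel_form g u Y T).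
  have idU v : U v -> U (id v) by [].
  have := gram_curvature_along oU oU smooth_id idU gsm gs gu X Y Z T Uu.
  by rewrite !WI !dIv.
move: (DE X Y) (DE Y X) gE' FE.
generalize ('D_X (fun v => gram (G (F v)) (W Y Z v) ('D_T F v)) u) => a.
generalize ('D_Y (fun v => gram (G (F v)) (W X Z v) ('D_T F v)) u) => b.
generalize ('D_X (fun v => gram (g v) (nabla_along g id Y ('D_Z id) v) ('D_T id v)) u) => a'.
generalize ('D_Y (fun v => gram (g v) (nabla_along g id X ('D_Z id) v) ('D_T id v)) u) => b'.
generalize (gram (g u) (curvature g u X Y Z) T).
generalize (gram (G (F u)) (curvature G (F u) ('D_X F u) ('D_Y F u) ('D_Z F u)) ('D_T F u)).
generalize (gram (G (F u)) (W Y Z u) (W X T u)) (gram (G (F u)) (W X Z u) (W Y T u)).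
generalize (gram (g u) (christoffel_form g u Y Z) (christoffel_form g u X T)).
generalize (gram (g u) (christoffel_form g u X Z) (christoffel_form g u Y T)).
by move=> p q r s k l -> -> -> ->; ring.
Qed.

End InducedMetric.

#[local] Opaque curvature.

(** * Hypersurfaces *)

Lemma Ck_sub (R : realType) n (W : normedModType R) k (U V : set 'rV[R]_n)
    (f : 'rV[R]_n -> W) : U `<=` V -> Ck k V f -> Ck k U f.
Proof.
move=> UV; elim: k f => [|k IH] f /=; first by move=> fc u /UV; exact: fc.
by move=> [fd fC]; split=> [u /UV|i]; [exact: fd|exact: IH].
Qed.

Section Metric.
Context {R : realType} {n : nat} (M : manifold R n) (g : metric M) (p : M).
Let G := metric_at g p.

Lemma coord_chart_at : img (chart_at p) (Defs.coord (chart_at p) p).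
Proof. by apply: coord_img; exact: chart_at_dom. Qed.

Lemma metric_at_sym : G^T = G.
Proof. by apply: gmx_sym; [exact: chart_at_atlas|exact: coord_chart_at]. Qed.

Lemma metric_at_unit : G \in unitmx.
Proof. by apply: gmx_unit; [exact: chart_at_atlas|exact: coord_chart_at]. Qed.

Lemma ricci_contract : ricci g p = ricci_contraction G (riemann g p).
Proof.
apply: form2P => X Y; rewrite /ricci /ricci_contraction; congr trace.
apply/funext => Z; apply/esym/sharp_unique; first exact: metric_at_unit.
by [].
Qed.

End Metric.

Section Hypersurface.
Context {R : realType} {n : nat} (M : manifold R n) (g : metric M).
Context (N : manifold R n.+1) (gN : metric N) (f : hypersurface g gN) (p : M).

Let x := chart_at p.
Let y := chart_at (f p).
Let u := Defs.coord x p.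
Let F := local_at f p.
Let U := local_dom f x y.
Let V := img y.
Let G := gmx gN y.
Let eps := normal_sign f.
Let H := second_fundamental f p.
Let xi := unit_normal f p.

Lemma normal_sign2 : eps ^+ 2 = 1.
Proof. by rewrite /eps; case: (normal_signP f) => ->; rewrite ?sqrrN expr1n. Qed.

Lemma open_local_dom : open U.
Proof.
rewrite openE => v [vx vy].
have nx : nbhs v (img x) by exact: open_nbhs_nbhs (conj (@img_open _ _ _ x) vx).
have fc : {for v, continuous (f \o param x)}.
  by apply: continuous_comp; [exact: param_continuous|exact: immersion_continuous].
have ny : nbhs v ((f \o param x) @^-1` Defs.dom y).
  apply: (fc (Defs.dom y)).
  exact: (@open_nbhs_nbhs _ (f (param x v)) (Defs.dom y) (conj (@dom_open _ _ _ y) vy)).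
exact: filterI nx ny.
Qed.

Lemma local_dom_u : U u.
Proof.
split; first exact: coord_chart_at.
by rewrite /= /u coordK; exact: chart_at_dom.
Qed.

Lemma local_at_u : F u = Defs.coord y (f p).
Proof. by rewrite /F /local_at /local_expr /= /u coordK //; exact: chart_at_dom. Qed.

Lemma local_at_img v : U v -> V (F v).
Proof. by move=> [_ vy]; exact: coord_img. Qed.

Lemma local_at_smooth : smooth U F.
Proof. by apply: immersion_smooth; exact: chart_at_atlas. Qed.

Lemma ambient_smooth : smooth V G.
Proof. by apply: gmx_smooth; exact: chart_at_atlas. Qed.

Lemma ambient_sym z : V z -> (G z)^T = G z.
Proof. by apply: gmx_sym; exact: chart_at_atlas. Qed.

Lemma ambient_unit z : V z -> G z \in unitmx.
Proof. by apply: gmx_unit; exact: chart_at_atlas. Qed.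

Lemma metric_smooth : smooth U (gmx g x).
Proof.
move=> k; apply: (Ck_sub (V := img x)); first by move=> v [].
by apply: gmx_smooth; exact: chart_at_atlas.
Qed.

Lemma metric_sym v : U v -> (gmx g x v)^T = gmx g x v.
Proof. by move=> [vx _]; apply: gmx_sym => //; exact: chart_at_atlas. Qed.

Lemma metric_unit v : U v -> gmx g x v \in unitmx.
Proof. by move=> [vx _]; apply: gmx_unit => //; exact: chart_at_atlas. Qed.

Lemma derive_local_at v X : U v -> 'D_X F v = X *m jacobian F v.
Proof.
by move=> Uv; apply: deriveEjacobian; exact: smooth_differentiable local_at_smooth Uv.
Qed.

Lemma metric_isometric v X Y : U v ->
  gram (gmx g x v) X Y = gram (G (F v)) ('D_X F v) ('D_Y F v).
Proof.
move=> Uv; rewrite !derive_local_at //.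
rewrite (immersion_isometric (h := f) (chart_at_atlas p) (chart_at_atlas (f p)) Uv).
Transparent gram.
by rewrite /gram trmx_mul !mulmxA.
Opaque gram.
Qed.

Let Gp := G (F u).
Let W X Y := nabla_along G F X ('D_Y F) u.
Let Gam X Y := christoffel_form (gmx g x) u X Y.

Lemma normal_unit : gram Gp xi xi = eps.
Proof.
by have := unit_normal_unit f p; rewrite /gform /metric_at -/y -local_at_u.
Qed.

Lemma normal_orthogonal X : gram Gp ('D_X F u) xi = 0.
Proof.
by have := unit_normal_orthogonal f p X; rewrite /gform /metric_at -/y -local_at_u.
Qed.

Lemma second_fundamentalE X Y : H X Y = gram Gp (W X Y) xi.
Proof. by rewrite /H /second_fundamental /gform /metric_at -/y -local_at_u. Qed.

(** The n rows of the Jacobian together with xi form a basis of the ambient tangent space; a vector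
    orthogonal to all of them vanishes by nondegeneracy. *)
Lemma normal_frame w : (forall X, gram Gp w ('D_X F u) = 0) -> gram Gp w xi = 0 -> w = 0.
Proof.
Transparent gram.
move=> wJ wxi; have Uu := local_dom_u.
have Gps : Gp^T = Gp by apply/ambient_sym/local_at_img.
have Gpu : Gp \in unitmx by apply/ambient_unit/local_at_img.
pose J := jacobian F u; pose K := col_mx J xi.
have Jfree : row_free J.
  exact: immersion_free (chart_at_atlas p) (chart_at_atlas (f p)) Uu.
have Kfree : row_free K.
  rewrite -kermx_eq0; apply/rowV0P => v /sub_kermxP.
  rewrite -[v]hsubmxK mul_row_col => vK.
  (* Pairing a linear relation with xi removes the tangential part and leaves the coefficient of xi
     times eps, which is nonzero. *)
  have b0 : rsubmx v = 0.
    have := congr1 (fun z => (z *m Gp *m xi^T) 0 0) vK.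
    rewrite mulmxDl mulmxDl mxE.
    have -> : (lsubmx v *m J *m Gp *m xi^T) 0 0 = 0.
      by rewrite -derive_local_at //; exact: normal_orthogonal.
    rewrite !mul0mx [RHS]mxE add0r [rsubmx v]mx11_scalar mul_scalar_mx -!scalemxAl mxE.
    rewrite -/(gram Gp xi xi) normal_unit => /eqP; rewrite mulf_eq0.
    case/orP => [/eqP ->|]; first by rewrite raddf0.
    by move/eqP => e0; have := normal_sign2; rewrite e0 expr0n => /esym/eqP; rewrite oner_eq0.
  move: vK; rewrite b0 mul0mx addr0 => vJ.
  suff -> : lsubmx v = 0 by rewrite row_mx0.
  by apply: (row_free_inj Jfree); rewrite mul0mx.
have Kfull : row_full K by rewrite /row_full (eqP Kfree) addn1.
have [B BK] := row_fullP Kfull.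
have Kw : K *m (Gp *m w^T) = 0.
  rewrite mul_col_mx; have -> : J *m (Gp *m w^T) = 0.
    apply/colP => j; have := wJ (delta_mx 0 j).
    rewrite (gramC _ _ Gps) derive_local_at // /gram -rowE -!row_mul -mulmxA mxE => ->.
    by rewrite mxE.
  have -> : xi *m (Gp *m w^T) = 0.
    by rewrite [LHS]mx11_scalar mulmxA -/(gram Gp xi w) (gramC _ _ Gps) wxi raddf0.
  exact: col_mx0.
have : Gp *m w^T = 0 by rewrite -[LHS]mul1mx -BK -mulmxA Kw mulmx0.
move/(congr1 (mulmx (invmx Gp))); rewrite mulKmx // mulmx0.
by move/(congr1 trmx); rewrite trmxK trmx0.
Opaque gram.
Qed.

(** By [normal_frame] it suffices to pair both sides with tangent vectors, using [gram_nabla_along],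
    and with xi, using eps^2 = 1. *)
Lemma gauss_formula X Y : W X Y = 'D_(Gam X Y) F u + (eps * H X Y) *: xi.
Proof.
have Uu := local_dom_u.
have Gps : Gp^T = Gp by apply/ambient_sym/local_at_img.
apply/eqP; rewrite -subr_eq0; apply/eqP; apply: normal_frame => [Z|].
  have E1 : gram Gp (W X Y) ('D_Z F u) = gram (gmx g x u) (Gam X Y) Z.
    exact: (gram_nabla_along open_local_dom (@img_open _ _ _ y) local_at_smooth local_at_img
     ambient_smooth ambient_sym ambient_unit metric_smooth metric_sym metric_unit metric_isometric).
  have E2 := metric_isometric (Gam X Y) Z Uu.
  have E3 : gram Gp xi ('D_Z F u) = 0 by rewrite (gramC _ _ Gps); exact: normal_orthogonal.
  move: E1 E2 E3; rewrite -/Gp.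
  generalize (W X Y) ('D_(Gam X Y) F u) ('D_Z F u) => w d z E1 E2 E3.
  by rewrite gramDl gramNl gramDl gramZl E1 E2 E3 mulr0 addr0 subrr.
have := normal_orthogonal (Gam X Y); rewrite second_fundamentalE.
generalize (W X Y) ('D_(Gam X Y) F u) => w d dxi.
rewrite gramDl gramNl gramDl gramZl normal_unit dxi add0r.
by rewrite mulrAC -expr2 normal_sign2 mul1r subrr.
Qed.

Lemma second_fundamentalC X Y : H X Y = H Y X.
Proof.
have E : W X Y = W Y X.
  exact: (nabla_alongC open_local_dom (@img_open _ _ _ y) local_at_smooth local_at_img
     ambient_smooth ambient_sym X Y local_dom_u).
by rewrite !second_fundamentalE E.
Qed.

Lemma second_fundamental_linear a X X' Y : H (a *: X + X') Y = a * H X Y + H X' Y.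
Proof.
have Uu := local_dom_u.
have WE A B : W A B =
    'D_A ('D_B F) u + christoffel_form G (F u) ('D_A F u) ('D_B F u) by [].
have E1 : 'D_(a *: X + X') ('D_Y F) u = a *: 'D_X ('D_Y F) u + 'D_X' ('D_Y F) u.
  apply: derive_linear.
  exact: smooth_differentiable (smooth_derive Y open_local_dom local_at_smooth) Uu.
have E2 : 'D_(a *: X + X') F u = a *: 'D_X F u + 'D_X' F u.
  by apply: derive_linear; exact: smooth_differentiable local_at_smooth Uu.
rewrite !second_fundamentalE !WE; move: E1 E2.
generalize ('D_(a *: X + X') ('D_Y F) u) ('D_(a *: X + X') F u) => p' q -> ->.
generalize ('D_X ('D_Y F) u) ('D_X' ('D_Y F) u) ('D_X F u) ('D_X' F u) ('D_Y F u).
move=> d d' e e' z; rewrite christoffel_formDl christoffel_formZl.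
generalize (christoffel_form G (F u) e z) (christoffel_form G (F u) e' z) => k k'.
by rewrite !(gramDl, gramZl); ring.
Qed.

Lemma gauss_equation X Y Z T : riemann g p X Y Z T =
  riemann gN (f p) ('D_X F u) ('D_Y F u) ('D_Z F u) ('D_T F u)
  + eps * (H X T * H Y Z - H X Z * H Y T).
Proof.
have Uu := local_dom_u.
have -> : riemann gN (f p) ('D_X F u) ('D_Y F u) ('D_Z F u) ('D_T F u) =
    gram Gp (curvature G (F u) ('D_X F u) ('D_Y F u) ('D_Z F u)) ('D_T F u).
  by rewrite /riemann /gform /metric_at /curvature_at -/y -local_at_u.
have GL := gauss_local open_local_dom (@img_open _ _ _ y) local_at_smooth
  local_at_img ambient_smooth ambient_sym ambient_unit metric_smooth metric_sym
  metric_unit metric_isometric X Y Z T Uu.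
have Gps : Gp^T = Gp by apply/ambient_sym/local_at_img.
(* Tangential parts cancel by isometry, mixed products vanish by orthogonality, and the normal parts
   contribute eps^3 = eps. *)
have key A B C D : gram Gp (W A B) (W C D) - gram (gmx g x u) (Gam A B) (Gam C D) =
    eps * H A B * H C D.
  rewrite !gauss_formula (metric_isometric (Gam A B) (Gam C D) Uu) -/Gp.
  move: (normal_orthogonal (Gam A B)) (normal_orthogonal (Gam C D)).
  generalize ('D_(Gam A B) F u) ('D_(Gam C D) F u) => d d' dxi dxi'.
  rewrite !(gramDl, gramDr, gramZl, gramZr) normal_unit dxi (gramC xi _ Gps) dxi'.
  have := normal_sign2; generalize eps (H A B) (H C D) (gram Gp d d') => e h k a e2.
  by transitivity (e ^+ 2 * (e * h * k)); [ring|rewrite e2 mul1r].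
set r := gram Gp (curvature G (F u) ('D_X F u) ('D_Y F u) ('D_Z F u)) ('D_T F u).
apply: etrans (etrans GL (f_equal2 (fun a b => r + a - b) (key Y Z X T) (key X Z Y T))) _.
generalize (H X T) (H Y Z) (H X Z) (H Y T) eps r => h1 h2 h3 h4 e k.
ring.
Qed.

End Hypersurface.

Section ConstantCurvature.
Context {R : realType} {m : nat} (N : manifold R m) (gN : metric N) (c : R).
Context (hcurv : constant_curvature gN c) (q : N).

(** For m = n+1 this ties c to the ambient scalar curvature, as in c = kt / (n(n+1)). *)
Lemma scalar_constant_curvature : scalar_curvature gN q = m%:R * (m%:R - 1) * c.
Proof.
have Gu := metric_at_unit gN q; have Gs := metric_at_sym gN q.
have ricE : ricci gN q = gram (((m%:R - 1) * c) *: metric_at gN q).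
  rewrite ricci_contract hcurv; apply: form2P => X Y.
  rewrite -[_ *: _]addr0 -(scale0r (kulkarni_nomizu (gform gN q) (gform gN q))).
  rewrite contraction_comb contraction_KN // mulmxV // mul1mx mxtrace1 gram_mxZ form2Z.
  by field.
rewrite /scalar_curvature ricE trace_g_gram // -scalemxAl mulmxV // linearZ /= mxtrace1.
by ring.
Qed.
End ConstantCurvature.

(** * Curvature of the hypersurface in terms of the matrices of g and H *)

Section HypersurfaceForms.
Context {R : realType} {n : nat} (M : manifold R n) (g : metric M).
Context (N : manifold R n.+1) (gN : metric N) (f : hypersurface g gN) (c : R).
Context (hcurv : constant_curvature gN c) (p : M).
Let G := metric_at g p.
Let Hm := form_mx (second_fundamental f p).
Let eps := normal_sign f.
Let b := \tr ((\tr (Hm *m invmx G) *: Hm - Hm *m invmx G *m Hm) *m invmx G).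

Lemma second_fundamental_gram : second_fundamental f p = gram Hm.
Proof.
apply: form_mxK => *; first exact: second_fundamental_linear.
exact: second_fundamentalC.
Qed.

Lemma second_fundamental_mx_sym : Hm^T = Hm.
Proof. by apply/matrixP => i j; rewrite !mxE; exact: second_fundamentalC. Qed.

Lemma riemann_hypersurface X1 X2 X3 X4 : riemann g p X1 X2 X3 X4 =
  c * (gram G X1 X4 * gram G X2 X3 - gram G X1 X3 * gram G X2 X4)
  + eps * (gram Hm X1 X4 * gram Hm X2 X3 - gram Hm X1 X3 * gram Hm X2 X4).
Proof.
rewrite (gauss_equation f) -second_fundamental_gram hcurv form4Z /kulkarni_nomizu.
set u := Defs.coord _ p.
have Uu := local_dom_u f p.
have gE X Y : gform gN (f p) ('D_X (local_at f p) u) ('D_Y (local_at f p) u) = gram G X Y.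
  rewrite /gform /metric_at -local_at_u; exact/esym/metric_isometric.
move: (gE X1 X4) (gE X2 X3) (gE X1 X3) (gE X2 X4).
generalize ('D_X1 (local_at f p) u) ('D_X2 (local_at f p) u) ('D_X3 (local_at f p) u)
  ('D_X4 (local_at f p) u) => v1 v2 v3 v4 -> -> -> ->.
rewrite -/eps; move: (gram G) (second_fundamental f p) => a h.
by field.
Qed.

Lemma ricci_hypersurface : ricci g p = gram (((n%:R - 1) * c) *: G
  + eps *: (\tr (Hm *m invmx G) *: Hm - Hm *m invmx G *m Hm)).
Proof.
have Gu := metric_at_unit g p.
rewrite ricci_contract; apply: form2P => X Y.
have -> : riemann g p = (c / 2) *: kulkarni_nomizu (gram G) (gram G) +
    (eps / 2) *: kulkarni_nomizu (gram Hm) (gram Hm).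
  apply: form4P => X1 X2 X3 X4.
  rewrite riemann_hypersurface form4D !form4Z /kulkarni_nomizu.
  by move: (gram G) (gram Hm) => a h; field.
rewrite contraction_comb !contraction_KN // mulmxV // mul1mx mxtrace1.
by rewrite !(gram_mxD, gram_mxN, gram_mxZ) !form2E; field.
Qed.

Lemma scalar_hypersurface : scalar_curvature g p = n%:R * (n%:R - 1) * c + eps * b.
Proof.
have Gu := metric_at_unit g p.
rewrite /scalar_curvature ricci_hypersurface trace_g_gram // (mulmxDl (_ *: G)) -!scalemxAl.
rewrite mulmxV // linearD !linearZ /= mxtrace1 -/b; ring.
Qed.

End HypersurfaceForms.

(** * The pointwise algebra applied at each point of U_H *)

Theorem theorem8p3 (R : realType) (n s : nat) (hn : (4 <= n)%N)
    (N : manifold R n.+1) (gN : metric N) (c kt : R)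
    (hsig : metric_signature s gN)
    (hcurv : constant_curvature gN c)
    (hkt : forall q : N, scalar_curvature gN q = kt)
    (M : manifold R n) (g : metric M) (f : hypersurface g gN)
    (hE : ~ einstein g) (hC : ~ conformally_flat g) :
  let nR : R := n%:R in
  let eps := normal_sign f in
  let H := second_fundamental f in
  let H2 := second_fundamental2 f in
  let H3 := second_fundamental3 f in
  let trH p := trace_g (metric_at g p) (H p) in
  let gg p := kulkarni_nomizu (gform g p) (gform g p) in
  let CC p := tdot (metric_at g p) (weyl g p) (weyl g p) in
  let rho (psi : M -> R) p :=
    (nR - 3)^-1 *
    (scalar_curvature g p / (nR - 1) - kt / (nR + 1) + eps * psi p) in
  let QSR (sigma : M -> R) p :=
    tachibana
      (ricci g p - ((nR - 1) * kt / (nR * (nR + 1)) - sigma p) *: gform g p)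
      (riemann g p
       - (kt / (nR * (nR + 1)) - sigma p / (nR - 2)) *: (2^-1 *: gg p)) in
  (forall psi : M -> R,
     (forall p, UH f p -> H3 p = trH p *: H2 p + psi p *: H p) ->
     forall p, UH f p ->
       CC p = ((nR - 3) / (nR - 2)) *: QSR (rho psi) p)
  /\
  (forall LC psi : M -> R,
     (forall p, UH f p -> CC p = LC p *: tachibana (gform g p) (weyl g p)) ->
     (forall p, UH f p -> H3 p = trH p *: H2 p + psi p *: H p) ->
     let tau p := rho psi p - (nR - 2) / (nR - 3) * LC p in
     (forall p, UH f p -> QSR tau p = 0) /\
     (exists lambda : M -> R,
        forall p, UH f p -> lambda p *: weyl g p = Etensor g p)).
Proof.
move=> nR eps H H2 H3 trH gg CC rho QSR.
have [n1 n2 n3] := natr_sub_neq0 (R := R) hn.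
have n0 : nR != 0 by rewrite pnatr_eq0 -lt0n; exact: leq_trans hn.
have n4 : nR + 1 != 0 by rewrite natr1 pnatr_eq0.
have eps2 : eps ^+ 2 = 1 by exact: normal_sign2.
have ktE (p : M) : kt = nR * (nR + 1) * c.
  rewrite -(hkt (f p)) (scalar_constant_curvature hcurv) -natr1.
  by rewrite -/nR; ring.
pose G p := metric_at g p; pose Hm p := form_mx (H p).
pose A p := \tr (Hm p *m invmx (G p)) *: Hm p - Hm p *m invmx (G p) *m Hm p.
pose b p := \tr (A p *m invmx (G p)).
have Gu p : G p \in unitmx by exact: metric_at_unit.
have Gs p : (G p)^T = G p by exact: metric_at_sym.
have Hs p : (Hm p)^T = Hm p by exact: second_fundamental_mx_sym.
have HE p : H p = gram (Hm p) by exact: second_fundamental_gram.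
have H2E p : H2 p = gram (Hm p *m invmx (G p) *m Hm p).
  by rewrite /H2 /second_fundamental2 -/H HE fmul_gram.
have H3E p : H3 p = gram (Hm p *m invmx (G p) *m (Hm p *m invmx (G p) *m Hm p)).
  by rewrite /H3 /second_fundamental3 -/H2 H2E -/H HE fmul_gram.
have riemE p := riemann_hypersurface f hcurv p.
have ricE p := ricci_hypersurface f hcurv p.
have scalE p := scalar_hypersurface f hcurv p.
pose Q p sg := tachibana (gram (A p + sg *: G p))
  (2^-1 *: kulkarni_nomizu (gram (Hm p)) (gram (Hm p))
   + (sg / (2 * (nR - 2))) *: kulkarni_nomizu (gram (G p)) (gram (G p))).
have QSRE sigma p X1 X2 X3 X4 X Y :
    QSR sigma p X1 X2 X3 X4 X Y = Q p (eps * sigma p) X1 X2 X3 X4 X Y.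
  rewrite /Q -(tachibana_ricci_riemann hn eps2 (riemE p)) /QSR ricE.
  have -> : (nR - 1) * kt / (nR * (nR + 1)) = (nR - 1) * c.
    by rewrite (ktE p); field; rewrite n0 n4.
  have -> : kt / (nR * (nR + 1)) = c by rewrite (ktE p); field; rewrite n0 n4.
  by [].
have cubic psi p : H3 p = trH p *: H2 p + psi *: H p ->
    Hm p *m invmx (G p) *m (Hm p *m invmx (G p) *m Hm p) =
    \tr (Hm p *m invmx (G p)) *: (Hm p *m invmx (G p) *m Hm p) + psi *: Hm p.
  rewrite H3E H2E /trH HE trace_g_gram // => e; apply: gram_inj.
  by rewrite e gram_mxD !gram_mxZ.
have rhoE psi p : eps * rho psi p = (nR - 3)^-1 * (b p / (nR - 1) + psi p).
  rewrite /rho scalE (ktE p) -/eps -/nR.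
  have -> : eps * ((nR - 3)^-1 * ((nR * (nR - 1) * c + eps * b p) / (nR - 1)
      - nR * (nR + 1) * c / (nR + 1) + eps * psi p)) =
      eps ^+ 2 * ((nR - 3)^-1 * (b p / (nR - 1) + psi p)).
    by field; rewrite n1 n3 n4.
  by rewrite eps2 mul1r.
have part1 psi p : H3 p = trH p *: H2 p + psi p *: H p ->
    CC p = ((nR - 3) / (nR - 2)) *: QSR (rho psi) p.
  move=> /cubic cub.
  apply: form6P => X1 X2 X3 X4 X Y.
  rewrite form6Z QSRE rhoE /CC /weyl ricE scalE.
  exact: (weyl_dot_weyl hn (Gs p) (Gu p) (Hs p) eps2 cub (riemE p)).
split=> [psi cub p Up|LC psi CL cub tau]; first exact/part1/cub.
have weylE p : weyl g p = eps *: weyl0 (G p) (Hm p).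
  by rewrite /weyl ricE scalE; exact: (weylE hn (riemE p)).
(* Part (i) and the hypothesis give (n-3)/(n-2) Q(eps rho) = LC Q(g, C); the shift from eps rho to
   eps tau subtracts exactly this contribution. *)
have Q0 p X1 X2 X3 X4 X Y : UH f p -> Q p (eps * tau p) X1 X2 X3 X4 X Y = 0.
  move=> Up; pose w := tachibana (gram (G p)) (weyl0 (G p) (Hm p)) X1 X2 X3 X4 X Y.
  have e1 : (nR - 3) / (nR - 2) * Q p (eps * rho psi p) X1 X2 X3 X4 X Y = LC p * (eps * w).
    rewrite -QSRE -form6Z -(part1 _ _ (cub p Up)) (CL p Up) form6Z weylE.
    congr (_ * _); rewrite /w /tachibana /derivation4 !form4Z; ring.
  have := tachibana_shift hn (Gs p) (Hs p) (eps * tau p) (eps * rho psi p) X1 X2 X3 X4 X Y.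
  rewrite /= -/(A p) -/nR -/(Q p _ X1 X2 X3 X4 X Y) -/(Q p _ X1 X2 X3 X4 X Y) -/w => ->.
  have -> : Q p (eps * rho psi p) X1 X2 X3 X4 X Y = (nR - 2) / (nR - 3) * (LC p * (eps * w)).
    by rewrite -e1; field; rewrite n2 n3.
  by rewrite /tau; ring.
split=> [p Up|].
  by apply: form6P => X1 X2 X3 X4 X Y; rewrite QSRE Q0.
(* The conclusion is stated as an implication, with the default 0 off U_H, so that choice yields a
   function on all of M. *)
have lamE p : exists l, UH f p -> l *: weyl g p = Etensor g p.
  have [Up|nUp] := pselect (UH f p); last by exists 0 => /nUp.
  have free : ~ exists x y, Hm p *m invmx (G p) *m Hm p = x *: G p + y *: Hm p.
    move=> [x [y e]]; apply: Up; exists x, y.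
    by rewrite -/(H2 p) -/(H p) H2E e HE gram_mxD !gram_mxZ.
  have [l lE] := weyl_proportional hn (Gs p) (Gu p) (Hs p) eps2 (cubic _ _ (cub p Up))
    (riemE p) free (fun X1 X2 X3 X4 X Y => Q0 p X1 X2 X3 X4 X Y Up).
  by exists l => _; rewrite /weyl /Etensor /ricci2 ricE scalE.
have [l lP] := choice lamE.
by exists l.
Qed.
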